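(* Suppose $\mu$ has a spectral gap on $X$. Then for $m_X$-a.e. $x\in X$ we have $\mu^{*n}*\delta_x\to m_X$ as $n\to\infty$ in the weak* topology. Moreover, for every fixed $f\in L^2(X,m_X)$, $$\limsup_{n\to\infty}\Big|\int_X f\,d(\mu^{*n}*\delta_x)-\int_X f\,dm_X\Big|^{1/n}\le\rho\big(\pi(\mu)|_{L^2_0}\big)^{1/2}$$ for $m_X$-a.e. $x\in X$, where $\rho(\pi(\mu)|_{L^2_0})$ is the spectral radius of $\pi(\mu)$ restricted to $L^2_0(X,m_X)$.
   Context: Standing assumptions: $G$ is a locally compact $\sigma$-compact metrizable group acting (measurably/continuously) ergodically on a locally compact $\sigma$-compact metrizable space $X$ carrying a $G$-invariant Borel probability measure $m_X$; $\mu$ is a Borel probability measure on $G$. $\mu^{*n}*\delta_x$ is the push-forward of $\mu^{\otimes n}\otimes\delta_x$ under $(g_n,\dots,g_1,x)\mapsto g_n\cdots g_1x$. The convolution operator is $\pi(\mu)f(x)=\int_G f(gx)\,d\mu(g)$; it is a contraction on each $L^p(X,m_X)$, and $\int f\,d(\mu^{*n}*\delta_x)=\pi(\mu)^nf(x)$. $L^2_0(X,m_X)$ is the space of $L^2$-functions with mean $0$. $\mu$ has a spectral gap on $X$ if $\pi(\mu)$ restricted to $L^2_0(X,m_X)$ has spectral radius strictly less than $1$. Weak* convergence is tested against compactly supported continuous functions. *)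

(* Defs.v *)
From HB Require Import structures.
From mathcomp Require Import all_boot all_order all_algebra.
From mathcomp Require Import all_classical all_reals all_analysis.
Set Implicit Arguments. Unset Strict Implicit. Unset Printing Implicit Defensive.
Import Order.TTheory GRing.Theory Num.Theory.
Import numFieldNormedType.Exports.
Local Open Scope classical_set_scope.
Local Open Scope ring_scope.

#[short(type="topMeasType")]
HB.structure Definition TopMeasurable (d : measure_display) :=
  {T of Topological T & Measurable d T}.

Section topological_notions.
Context (R : realType).

Definition borel_space d (T : topMeasType d) : Prop :=
  (@measurable d T) = <<s @open T >>.

Definition sigma_compact (T : topologicalType) : Prop :=
  exists K : nat -> set T, (forall n, compact (K n)) /\ \bigcup_n K n = [set: T].

Definition metrizable (T : topologicalType) : Prop :=
  exists dist : T -> T -> R,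
    [/\ forall x y, dist x y = 0 <-> x = y,
        forall x y, dist x y = dist y x,
        forall x y z, dist x z <= dist x y + dist y z &
        forall A : set T, open A <->
          (forall x, A x -> exists2 e, 0 < e & [set y | dist x y < e] `<=` A)].

Definition lcsc_metrizable (T : topologicalType) : Prop :=
  [/\ locally_compact [set: T], sigma_compact T & metrizable T].
End topological_notions.

Section groups_actions.
Context (G : Type) (mul : G -> G -> G) (inv : G -> G) (one : G).

Definition is_group : Prop :=
  [/\ forall a b c, mul a (mul b c) = mul (mul a b) c,
      forall a, mul one a = a &
      forall a, mul (inv a) a = one].

Definition is_action (X : Type) (act : G -> X -> X) : Prop :=
  (forall x, act one x = x) /\ (forall g h x, act (mul g h) x = act g (act h x)).
End groups_actions.

Definition topological_group (G : topologicalType)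
    (mul : G -> G -> G) (inv : G -> G) (one : G) : Prop :=
  [/\ is_group mul inv one, continuous (fun p : G * G => mul p.1 p.2) &
      continuous inv].

Section measure_notions.
Context (R : realType) (dG dX : measure_display)
  (G : measurableType dG) (X : measurableType dX) (act : G -> X -> X).

Definition invariant_measure (m : set X -> \bar R) : Prop :=
  forall g A, measurable A -> m (act g @^-1` A) = m A.

Definition ergodic_measure (m : set X -> \bar R) : Prop :=
  forall A, measurable A -> (forall g, act g @^-1` A = A) ->
    m A = 0%E \/ m A = 1%E.

Fixpoint conv_orbit (mu : set G -> \bar R) (n : nat) (x : X) : set X -> \bar R :=
  match n with
  | 0 => dirac x
  | n'.+1 => pushforward (product_measure1 mu (conv_orbit mu n' x))
               (fun p : G * X => act p.1 p.2)
  end.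

Definition conv_op (mu : {measure set G -> \bar R}) (f : X -> R) (x : X) : R :=
  Rintegral mu setT (fun g => f (act g x)).
End measure_notions.

Section L2.
Context (R : realType) (d : measure_display) (X : measurableType d)
  (m : {measure set X -> \bar R}).

Definition L2 (f : X -> R) : Prop :=
  measurable_fun setT f /\ (\int[m]_x ((f x) ^+ 2)%:E < +oo)%E.

Definition L2_0 (f : X -> R) : Prop := L2 f /\ Rintegral m setT f = 0.

Definition aeeq (f g : X -> R) : Prop := \forall x \ae m, f x = g x.

(* lambda = a + i b is in the resolvent set of (the complexification of) T
   on L^2_0: T - lambda is a bijection of the complex space L^2_0 (modulo
   null functions), u + i v written as the pair (u, v) of real functions. *)
Definition in_resolvent (T : (X -> R) -> X -> R) (a b : R) : Prop :=
  (forall u v, L2_0 u -> L2_0 v ->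
     aeeq (fun x => T u x - a * u x + b * v x) (fun=> 0) ->
     aeeq (fun x => T v x - a * v x - b * u x) (fun=> 0) ->
     aeeq u (fun=> 0) /\ aeeq v (fun=> 0)) /\
  (forall p q, L2_0 p -> L2_0 q ->
     exists u v, [/\ L2_0 u, L2_0 v,
       aeeq (fun x => T u x - a * u x + b * v x) p &
       aeeq (fun x => T v x - a * v x - b * u x) q]).

Definition spectral_radius (T : (X -> R) -> X -> R) : R :=
  sup [set r | exists a b, ~ in_resolvent T a b /\ r = Num.sqrt (a ^+ 2 + b ^+ 2)].

Definition spectral_gap (T : (X -> R) -> X -> R) : Prop :=
  spectral_radius T < 1.
End L2.

(* Main.v *)
(** Fix [r] above the spectral radius [rho] of [pi(mu)] on [L^2_0].  If
    [||pi(mu)^n h||_2 <= C r^n] for [h] in [L^2_0], then summing the squares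
    divided by [s^(2n)], [s > r], shows that for almost every [x] the sequence
    [pi(mu)^n h(x)] is [O(s^n)]; as [s] decreases to [rho] this bounds the
    limsup by [rho <= sqrt rho].  Since [rho < 1], for almost every [x] the
    measures [mu^{*n} * delta_x] converge on each set of a countable family
    made from a countable base of [X]; functions in [C_c(X)] are uniform limits
    of step functions over that family, whence the weak* convergence.

    The operator bound is the upper half of Gelfand's formula, obtained without
    contour integrals.  By Baire's argument and compactness, the inverses of
    [1 - l T] are uniformly bounded, hence Lipschitz in [l], on a disc
    [|l| <= t].  The inverse of [1 - (l T)^(2^k)] is the average of those of
    [1 - w l T] over the [2^k]-th roots of unity [w], so it has the same
    Lipschitz constant for every [k]; a power bound for [T] at radius [s] can
    therefore be pushed to radius [s + delta] with [delta] independent of [s],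
    and finitely many steps reach every radius below [t]. *)
Require Import Defs.
From HB Require Import structures.
From mathcomp Require Import all_boot all_order all_algebra.
From mathcomp Require Import all_classical all_reals all_analysis.
From mathcomp Require Import measurable_realfun complex ring lra.
Set Implicit Arguments. Unset Strict Implicit. Unset Printing Implicit Defensive.
Import Order.TTheory GRing.Theory Num.Theory.
Import numFieldNormedType.Exports.
Import complex.ComplexField.Normc.
Local Open Scope classical_set_scope.
Local Open Scope ring_scope.

(** * Gelfand's formula in complex Banach spaces *)

(** Limits in the spaces below are known only through error bounds of order [2^-n]; this turns such
    bounds into exact inequalities. *)
Lemma le_of_half_pow (R : realType) (a b c : R) (n0 : nat) :
  (forall n, (n0 <= n)%N -> a <= b + c * 2^-1 ^+ n) -> a <= b.
Proof.
move=> h; apply/ler_addgt0Pr => e e0.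
have [c0|c0] := leP c 0.
  have := h n0 (leqnn _); have : c * 2^-1 ^+ n0 <= 0.
    by rewrite mulr_le0_ge0// exprn_ge0.
  lra.
have := @cvg_expr R (2^-1).
rewrite ger0_norm// => /(_ ltac:(lra)) /cvgrPdist_lt /(_ (e / c)).
rewrite divr_gt0// => /(_ isT) [n1 _ hn1].
have := hn1 (maxn n0 n1) (leq_maxr _ _).
rewrite sub0r normrN ger0_norm ?exprn_ge0// ltr_pdivlMr// mulrC => h1.
have := h _ (leq_maxl n0 n1); lra.
Qed.

Section normc.
Context (R : realType).

Lemma normcN1 : normc (-1 : R[i]) = 1.
Proof. by rewrite /normc/= oppr0 expr0n addr0 sqrrN expr1n sqrtr1. Qed.

Lemma normc_real (t : R) : normc (t%:C)%C = `|t|.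
Proof. by rewrite /normc/= expr0n addr0 sqrtr_sqr. Qed.

Lemma normc_ge0 (z : R[i]) : 0 <= normc z.
Proof. by case: z => a b; rewrite sqrtr_ge0. Qed.

Lemma normcX (z : R[i]) n : normc (z ^+ n) = normc z ^+ n.
Proof. by elim: n => [|n IH]; rewrite ?expr0 ?normc1// !exprS normcM IH. Qed.

Lemma normc_le (a b : R) : normc (a +i* b)%C <= `|a| + `|b|.
Proof.
rewrite -(ler_pXn2r (ltn0Sn 1)) ?nnegrE ?sqrtr_ge0 ?addr_ge0//=.
rewrite sqr_sqrtr ?addr_ge0 ?sqr_ge0// sqrrD !real_normK ?num_real//.
by rewrite lerD2r lerDl mulrn_wge0 ?mulr_ge0.
Qed.

End normc.

Section banach.
Context (R : realType) (V : lmodType R[i]) (N : V -> R).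

(** Completeness is stated without a topology, for sequences with steps at most [2^-n]. The constant
    4, rather than 2, leaves room for adding the errors of a real and an imaginary part. *)
Record banach_norm : Prop := BanachNorm {
  bnormD : forall x y, N (x + y) <= N x + N y ;
  bnormZ : forall z x, N (z *: x) = normc z * N x ;
  bnorm_eq0 : forall x, N x = 0 -> x = 0 ;
  bnorm_complete : forall u : nat -> V,
    (forall n, N (u n.+1 - u n) <= 2^-1 ^+ n) ->
    exists l, forall n, N (u n - l) <= 4 * 2^-1 ^+ n }.

Hypothesis bN : banach_norm.

Lemma bnorm0 : N 0 = 0.
Proof. by rewrite -(scale0r 0) bnormZ// normc0 mul0r. Qed.

Lemma bnormN x : N (- x) = N x.
Proof. by rewrite -scaleN1r bnormZ// normcN1 mul1r. Qed.

Lemma bnormB x y : N (x - y) <= N x + N y.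
Proof. by rewrite -(bnormN y) bnormD. Qed.

Lemma bnormBC x y : N (x - y) = N (y - x).
Proof. by rewrite -bnormN opprB. Qed.

Lemma bnorm_dist x y z : N (x - z) <= N (x - y) + N (y - z).
Proof. by rewrite -[X in N X <= _](@subrKA _ y) bnormD. Qed.

Lemma bnorm_ge0 x : 0 <= N x.
Proof. have := bnormB x x; rewrite subrr bnorm0; lra. Qed.

Lemma bnormZr (t : R) x : N ((t%:C)%C *: x) = `|t| * N x.
Proof. by rewrite bnormZ// normc_real. Qed.

(** * The bounded inverse theorem *)

Section inverse_bounded.
Variable S : {linear V -> V}.
Variable C : R.
Hypothesis Sbnd : forall x, N (S x) <= C * N x.
Hypothesis Ssurj : forall y, exists x, S x = y.
Hypothesis Sinj : forall x, S x = 0 -> x = 0.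

(* Baire's argument: otherwise nested balls avoid the images of all the balls
   of radius [n], and their common point has no preimage. *)
Lemma dense_image_in_ball : exists (n : nat) y0 e, 0 < e /\
  forall y, N (y - y0) < e -> forall d, 0 < d ->
    exists2 x, N x <= n%:R & N (y - S x) < d.
Proof.
apply: contrapT => H.
(* Given a ball with centre [p.1] and radius [p.2], the failure of density yields a smaller ball [q]
   inside it whose centre is at distance at least [2 * q.2] from every [S x] with [N x <= n]. *)
have step (n : nat) (p : V * R) : exists q : V * R, 0 < p.2 ->
  [/\ 0 < q.2, q.2 <= p.2 / 2, N (q.1 - p.1) <= p.2 / 2 &
      forall x, N x <= n%:R -> 2 * q.2 <= N (q.1 - S x)].
  have [p0|] := boolP (0 < p.2); last by exists (0, 0).
  apply: contrapT => H'; apply: H; exists n, p.1, (p.2 / 2).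
  split; first lra.
  move=> y yp d d0; apply: contrapT => H2; apply: H'.
  exists (y, Num.min (d / 2) (p.2 / 2)) => _ /=; split.
  - by rewrite lt_min; apply/andP; split; lra.
  - by rewrite ge_min lexx orbT.
  - exact: ltW.
  - move=> x xn; rewrite leNgt; apply/negP => h; apply: H2; exists x => //.
    apply: (lt_le_trans h); have : Num.min (d / 2) (p.2 / 2) <= d / 2.
      by rewrite ge_min lexx.
    lra.
have [F HF] := choice (fun np : nat * (V * R) => step np.1 np.2).
pose p := fix p n := match n with 0%N => (0, 1) | m.+1 => F (m, p m) end.
have pgt0 n : 0 < (p n).2.
  by elim: n => [|n IH] //=; have [] := HF (n, p n) IH.
have pS n := HF (n, p n) (pgt0 n).
have pr n : (p n).2 <= 2^-1 ^+ n.
  elim: n => [|n IH] //; have [_ /= h _ _] := pS n.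
  by rewrite exprS; move: IH h; lra.
have pc n : N ((p n.+1).1 - (p n).1) <= 2^-1 ^+ n.
  by have [_ _ /= h _] := pS n; have := pr n; have := pgt0 n; lra.
have [l hl] := bnorm_complete bN pc.
(* The balls are nested, so the limit [l] of the centres lies in all of them. *)
have inv n k : N ((p (k + n)%N).1 - (p n).1) + (p (k + n)%N).2 <= (p n).2.
  elim: k => [|k IH]; first by rewrite add0n subrr bnorm0 add0r.
  have [_ /= h1 h2 _] := pS (k + n)%N.
  have := bnorm_dist (p (k + n).+1).1 (p (k + n)%N).1 (p n).1.
  by move: h1 h2 IH => /=; lra.
have lin n : N (l - (p n).1) <= (p n).2.
  apply: (@le_of_half_pow _ _ _ 4 n) => m nm.
  have := inv n (m - n)%N; rewrite subnK// => h.
  have := hl m; rewrite (bnormBC _ l) => h2.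
  have := bnorm_dist l (p m).1 (p n).1; have := pgt0 m; lra.
have [x xl] := Ssurj l.
have [n xn] : exists n : nat, N x <= n%:R.
  by exists (Num.bound (N x)); apply: ltW; apply: archi_boundP; exact: bnorm_ge0.
(* A preimage [x] of [l] with [N x <= n] contradicts the choice of ball [n.+1]: [l] is within its
   radius of its centre, but [S x] is at least twice that radius away. *)
have [/= h _ _ /(_ x xn)] := pS n.
rewrite xl => h2; have := lin n.+1; have := pgt0 n.+1; rewrite (bnormBC l) /=; lra.
Qed.

(** Subtracting approximate preimages of [z + y0] and [y0] moves the ball to the origin; homogeneity
    then reaches every [y]. *)
Lemma approx_preimage : exists2 K, 0 < K &
  forall y, exists2 x, N x <= K * N y & N (y - S x) <= N y / 2.
Proof.
have [n [y0 [e [e0 H]]]] := dense_image_in_ball.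
have H2 z d : 0 < d -> N z < e -> exists2 x, N x <= 2 * n%:R & N (z - S x) < d.
  move=> d0 ze.
  have [|x1 h1 k1] := H (z + y0) _ (d / 2) ltac:(lra); first by rewrite addrK.
  have [|x2 h2 k2] := H y0 _ (d / 2) ltac:(lra); first by rewrite subrr bnorm0.
  exists (x1 - x2); first by have := bnormB x1 x2; lra.
  rewrite linearB/=.
  have -> : z - (S x1 - S x2) = (z + y0 - S x1) - (y0 - S x2).
    by rewrite !opprB [RHS](AC (3*2) ((1*(4*3))*(2*5))) /= subrr addr0.
  have := bnormB (z + y0 - S x1) (y0 - S x2); lra.
have n0 : (0 : R) <= n%:R by [].
(* The summand 1 keeps the constant positive when [n = 0]. *)
exists (4 * n%:R / e + 1) => [|y].
  by rewrite ltr_wpDl// divr_ge0//; lra.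
have [y00|yN0] := eqVneq (N y) 0.
  exists 0; first by rewrite bnorm0 y00 mulr0.
  by rewrite linear0 subr0 y00 mul0r.
have ypos : 0 < N y by rewrite lt_neqAle eq_sym yN0 bnorm_ge0.
(* This factor scales [y] to norm [e / 2]; an error [e / 4] there becomes [N y / 2] after scaling
   back. *)
pose t := e / (2 * N y).
have t0 : 0 < t by rewrite divr_gt0// mulr_gt0.
have tC0 : (t%:C)%C != 0 :> R[i] by apply/eqP => -[] h; move: t0; rewrite h ltxx.
have ht : t * N y = e / 2 by rewrite /t; field; rewrite yN0.
have [|x hx kx] := H2 ((t%:C)%C *: y) (e / 4) ltac:(lra).
  by rewrite bnormZr gtr0_norm// ht; lra.
have xE : x = (t%:C)%C *: ((t%:C)%C^-1 *: x) by rewrite scalerA divff// scale1r.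
exists ((t%:C)%C^-1 *: x).
  rewrite -(ler_pM2l t0).
  rewrite -[X in X * N (_ *: x)](gtr0_norm t0) -bnormZr -xE.
  apply: (le_trans hx).
  rewrite mulrCA ht.
  have -> : (4 * n%:R / e + 1) * (e / 2) = 2 * n%:R + e / 2 by field; lra.
  lra.
rewrite -(ler_pM2l t0) -[X in X * N (_ - _)](gtr0_norm t0) -bnormZr scalerBr.
rewrite -linearZ/= -xE mulrA ht; lra.
Qed.

(** Correcting the residual by approximate preimages halves it each time; the corrections sum to a
    preimage of [S x], which is [x] by injectivity. *)
Lemma inverse_bounded : exists2 M, 0 < M & forall x, N x <= M * N (S x).
Proof.
have [K K0 HK] := approx_preimage.
have [F HF] := choice (fun y => let: ex_intro2 x a b := HK y in
  ex_intro (fun x => N x <= K * N y /\ N (y - S x) <= N y / 2) x (conj a b)).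
(* Under this normalisation the [n]-th correction has norm at most [2^-n], so completeness applies
   directly. *)
have small x : K * N (S x) <= 1 -> N x <= 4.
  set y := S x => Ky.
  (* [r] is the residual and [s] the sum of the corrections made so far. *)
  pose r := fix r n := match n with 0%N => y | m.+1 => r m - S (F (r m)) end.
  pose s := fix s n := match n with 0%N => 0 | m.+1 => s m + F (r m) end.
  have rn n : N (r n) <= N y * 2^-1 ^+ n.
    elim: n => [|n IH]; first by rewrite expr0 mulr1.
    rewrite /= exprS; have [_] := HF (r n); lra.
  have sr n : S (s n) = y - r n.
    elim: n => [|n IH] /=; first by rewrite linear0 subrr.
    by rewrite linearD/= IH opprB addrA addrAC.
  have [n|l hl] := bnorm_complete bN (u := s).
    rewrite /= addrAC subrr add0r; have [h _] := HF (r n); apply: (le_trans h).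
    have h2 := rn n; have h3 : K * N (r n) <= K * (N y * 2^-1 ^+ n) by rewrite ler_pM2l.
    apply: (le_trans h3); rewrite mulrA ler_piMl// exprn_ge0//.
  have Sl : S l = y.
    apply/eqP; rewrite -subr_eq0; apply/eqP/(bnorm_eq0 bN)/eqP.
    rewrite eq_le bnorm_ge0 andbT.
    apply: (@le_of_half_pow _ _ _ (`|C| * 4 + N y) 0) => n _; rewrite add0r.
    have h1 : N (S (s n - l)) <= `|C| * (4 * 2^-1 ^+ n).
      apply: (le_trans (Sbnd _)); apply: (@le_trans _ _ (`|C| * N (s n - l))).
        by rewrite ler_wpM2r// ?bnorm_ge0// ler_norm.
      by rewrite ler_wpM2l.
    have -> : S l - y = - (S (s n - l) + r n).
      by rewrite linearB/= sr addrAC subrK opprB.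
    rewrite bnormN; have := bnormD bN (S (s n - l)) (r n); have := rn n; lra.
  have -> : x = l.
    by apply/eqP; rewrite -subr_eq0; apply/eqP/Sinj; rewrite linearB/= Sl subrr.
  by have := hl 0%N; rewrite sub0r bnormN expr0 mulr1.
exists (4 * K) => [|x]; first lra.
have [Sx0|Sx0] := eqVneq (N (S x)) 0.
  by rewrite Sx0 (Sinj (bnorm_eq0 bN Sx0)) bnorm0 mulr0.
have Spos : 0 < N (S x) by rewrite lt_neqAle eq_sym Sx0 bnorm_ge0.
pose t := (K * N (S x))^-1.
have t0 : 0 < t by rewrite invr_gt0 mulr_gt0.
have tk : t * (K * N (S x)) = 1 by rewrite mulVf// gt_eqF// mulr_gt0.
have := small ((t%:C)%C *: x).
rewrite linearZ/= !bnormZr gtr0_norm// mulrCA tk => /(_ (lexx _)) h.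
rewrite -(ler_pM2l t0); apply: (le_trans h).
by rewrite -mulrA mulrCA tk mulr1.
Qed.
End inverse_bounded.

(** * Resolvents of a contraction and the growth of its powers *)

Section gelfand.
Variable T : {linear V -> V}.
Hypothesis T1 : forall x, N (T x) <= N x.

(** The variable [l] is the inverse of the spectral parameter: the outside of a disc containing the
    spectrum becomes a compact disc around 0. *)
Definition one_sub (l : R[i]) (x : V) : V := x - l *: T x.

Fact one_sub_linear l : linear (one_sub l).
Proof.
move=> a x y; rewrite /one_sub linearP scalerDr scalerBr opprD addrACA.
by congr (_ + _ + _); rewrite !scalerA mulrC.
Qed.

HB.instance Definition _ l := GRing.isLinear.Build R[i] V V *:%R (one_sub l)
  (one_sub_linear l).

Definition bijective_one_sub l :=
  (forall x, one_sub l x = 0 -> x = 0) /\ (forall y, exists x, one_sub l x = y).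

Lemma one_sub_bounded l x : N (one_sub l x) <= (1 + normc l) * N x.
Proof.
apply: (le_trans (bnormB _ _)); rewrite mulrDl mul1r lerD2l bnormZ//.
by rewrite ler_wpM2l ?normc_ge0.
Qed.

Lemma iterTD n x y : iter n T (x + y) = iter n T x + iter n T y.
Proof. by elim: n => [|n IH] //=; rewrite IH linearD. Qed.

Lemma iterTZ n l x : iter n T (l *: x) = l *: iter n T x.
Proof. by elim: n => [|n IH] //=; rewrite IH linearZ. Qed.

Lemma iterTB n x y : iter n T (x - y) = iter n T x - iter n T y.
Proof. by rewrite iterTD -scaleN1r iterTZ scaleN1r. Qed.

(** [l T] has norm at most 1/2, so the Neumann iteration [u := z + l T u] converges, and a fixed
    vector of [l T] vanishes. *)
Lemma small_resolvent_bijective l : normc l <= 2^-1 -> bijective_one_sub l.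
Proof.
move=> l2; split=> [x /eqP|y].
  rewrite subr_eq0 => /eqP xE; apply: (bnorm_eq0 bN); apply/eqP.
  rewrite eq_le bnorm_ge0 andbT.
  have : N x <= 2^-1 * N x.
    by rewrite [X in N X <= _]xE bnormZ// ler_pM ?normc_ge0 ?bnorm_ge0.
  lra.
have bnd z : N (l *: T z) <= 2^-1 * N z.
  by rewrite bnormZ// ler_pM ?normc_ge0 ?bnorm_ge0.
have small z : N z <= 1 -> exists x, one_sub l x = z.
  move=> z1; pose u := fix u n := match n with 0%N => 0 | m.+1 => z + l *: T (u m) end.
  have [n|x hx] := bnorm_complete bN (u := u).
    elim: n => [|n IH]; first by rewrite /= linear0 scaler0 addr0 subr0 expr0.
    have -> : u n.+2 - u n.+1 = l *: T (u n.+1 - u n).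
      by rewrite linearB scalerBr /= opprD addrACA subrr add0r.
    by rewrite exprS; apply: (le_trans (bnd _)); rewrite ler_wpM2l.
  exists x; apply/eqP; rewrite -subr_eq0; apply/eqP/(bnorm_eq0 bN)/eqP.
  rewrite eq_le bnorm_ge0 andbT; apply: (@le_of_half_pow _ _ _ 6 0) => n _.
  have h1 := hx n.+1; have h2 := bnd (u n - x); have h3 := hx n.
  have -> : one_sub l x - z = l *: T (u n - x) - (u n.+1 - x).
    rewrite /one_sub linearB scalerBr /= opprB opprD.
    by rewrite [RHS](AC (2*(1*2)) (3*2*4*(1*5)))/= subrr addr0.
  have := bnormB (l *: T (u n - x)) (u n.+1 - x).
  have : 0 <= 2^-1 ^+ n :> R by rewrite exprn_ge0.
  move: h1; rewrite exprS; lra.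
have [y0|yN0] := eqVneq (N y) 0.
  by exists 0; rewrite linear0 (bnorm_eq0 bN y0).
have ypos : 0 < N y by rewrite lt_neqAle eq_sym yN0 bnorm_ge0.
have [|x hx] := small (((N y)^-1%:C)%C *: y).
  by rewrite bnormZr ger0_norm ?invr_ge0 ?bnorm_ge0// mulVf.
exists ((N y)%:C%C *: x); rewrite linearZ/= hx scalerA.
by rewrite -rmorphM/= divff// scale1r.
Qed.

Section step.
Variables (t M : R).
Hypothesis M0 : 0 < M.
Hypothesis bij : forall l, normc l <= t -> bijective_one_sub l.
Hypothesis bndM : forall l, normc l <= t -> forall x, N x <= M * N (one_sub l x).

(** Iterated square roots give [w] with [(w l)^(2^k) = - l^(2^k)], so the factor [1 + (l T)^(2^k)]
    is again of the shape [1 - (l' T)^(2^k)] with the same modulus of parameter. *)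
Lemma exists_root_opp1 k : exists w : R[i], w ^+ (2 ^ k) = -1.
Proof.
elim: k => [|k [w hw]]; first by exists (-1); rewrite expn0 expr1.
by exists (sqrtC w); rewrite expnS exprM sqrtCK.
Qed.

Lemma normc_root_opp1 k (w : R[i]) : w ^+ (2 ^ k) = -1 -> normc w = 1.
Proof.
move=> hw; apply/eqP; rewrite -(@pexpr_eq1 _ _ (2 ^ k)) ?expn_gt0 ?normc_ge0//.
by rewrite -normcX hw normcN1.
Qed.

(* [1 - A^2 = (1 - A)(1 + A)] and [1 + A] is again of the form
   [1 - (w l)^(2^k) T^(2^k)] *)
Lemma one_sub_pow_inj k l x : normc l <= t ->
  x - l ^+ (2 ^ k) *: iter (2 ^ k) T x = 0 -> x = 0.
Proof.
elim: k l x => [|k IH] l x lt; first by rewrite expn0 expr1 /=; have [h _] := bij lt; exact: h.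
have [w hw] := exists_root_opp1 k.
have wlt : normc (w * l) <= t by rewrite normcM (normc_root_opp1 hw) mul1r.
rewrite expnS mul2n -addnn exprD iterD => h.
apply: (IH (w * l)) => //; rewrite exprMn hw mulN1r scaleNr opprK.
apply: (IH l) => //; rewrite -[RHS]h iterTD iterTZ scalerDr scalerA.
by rewrite opprD addrA addrK.
Qed.

(* [(1 - (l T)^(2^k))^-1] is the average of the resolvents at the [2^k]-th
   roots of [l^(2^k)], hence as Lipschitz along rays as the resolvent. *)
Lemma resolvent_pow_lipschitz k l c f : normc l <= t -> 0 <= c <= 1 ->
  exists v v', [/\ v - l ^+ (2 ^ k) *: iter (2 ^ k) T v = f,
    v' - (c%:C%C * l) ^+ (2 ^ k) *: iter (2 ^ k) T v' = f &
    N (v - v') <= (1 - c) * normc l * M ^+ 2 * N f].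
Proof.
move=> lt c01; elim: k l lt => [|k IH] l lt.
  have clt : normc (c%:C%C * l) <= t.
    rewrite normcM normc_real ger0_norm; last by case/andP: c01.
    by apply: le_trans lt; rewrite ler_piMl ?normc_ge0//; case/andP: c01.
  have [_ /(_ f) [v hv]] := bij lt; have [_ /(_ f) [v' hv']] := bij clt.
  exists v, v'; rewrite expn0 !expr1 /=; split => //.
  apply: (le_trans (bndM lt _)).
  (* The resolvent identity; one factor [M] bounds [v - v'] and the other bounds [v']. *)
  have -> : one_sub l (v - v') = ((1 - c)%:C%C * l) *: T v'.
    rewrite linearB/= hv -hv' /one_sub opprB.
    rewrite rmorphB rmorph1 mulrBl mul1r scalerBl.
    by rewrite [LHS](AC (2*2) ((3*2)*(1*4)))/= subrr addr0.
  rewrite bnormZ// normcM normc_real ger0_norm ?subr_ge0; last by case/andP: c01.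
  have h1 : N (T v') <= M * N f.
    by apply: (le_trans (T1 _)); rewrite -hv'; apply: bndM.
  have -> : (1 - c) * normc l * M ^+ 2 * N f = M * ((1 - c) * normc l * (M * N f)) by ring.
  rewrite ler_pM2l// ler_wpM2l// mulr_ge0 ?normc_ge0 ?subr_ge0//; by case/andP: c01.
have [w hw] := exists_root_opp1 k.
have wlt : normc (w * l) = normc l by rewrite normcM (normc_root_opp1 hw) mul1r.
have [v1 [v1' [h1 h1' b1]]] := IH l lt.
have [|v2 [v2' [h2 h2' b2]]] := IH (w * l); first by rewrite wlt.
(* [(1 - A^2)^-1] is half the sum of [(1 - A)^-1] and [(1 + A)^-1], where [A] is [(m T)^(2^k)]. *)
have avg (m : R[i]) u1 u2 : u1 - m ^+ (2 ^ k) *: iter (2 ^ k) T u1 = f ->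
  u2 - (w * m) ^+ (2 ^ k) *: iter (2 ^ k) T u2 = f ->
  let u := 2^-1 *: (u1 + u2) in
  u - m ^+ (2 ^ k.+1) *: iter (2 ^ k.+1) T u = f.
  set n := (2 ^ k)%N; set a := m ^+ n => e1.
  rewrite exprMn -/n hw mulN1r scaleNr opprK -/a => e2 /=.
  rewrite expnS mul2n -addnn exprD iterD -/n -/a !iterTZ scalerA.
  rewrite [a * a * _]mulrC -scalerA -scalerBr.
  have -> : u1 + u2 - (a * a) *: iter n T (iter n T (u1 + u2)) = f *+ 2.
    have g1 : f + a *: iter n T f = u1 - (a * a) *: iter n T (iter n T u1).
      rewrite -[in LHS]e1 -scaleNr iterTD iterTZ scalerDr scalerA mulrN !scaleNr.
      by rewrite addrA subrK.
    have g2 : f - a *: iter n T f = u2 - (a * a) *: iter n T (iter n T u2).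
      rewrite -[in LHS]e2 iterTD iterTZ scalerDr scalerA.
      by rewrite opprD addrA addrK.
    by rewrite !iterTD scalerDr opprD addrACA -g1 -g2 addrACA subrr addr0 mulr2n.
  by rewrite -scaler_nat scalerA mulVf ?scale1r// pnatr_eq0.
exists (2^-1 *: (v1 + v2)), (2^-1 *: (v1' + v2')); split.
- exact: avg.
- by apply: avg => //; rewrite mulrCA.
- rewrite -scalerBr opprD addrACA.
  have -> : (2^-1 : R[i]) = ((2^-1 : R)%:C)%C by rewrite fmorphV rmorph_nat.
  rewrite bnormZr ger0_norm ?invr_ge0//.
  have := bnormD bN (v1 - v1') (v2 - v2'); move: b1 b2; rewrite wlt; lra.
Qed.

(** Solve the equation with right-hand side [f] at radii [s'] and [s]. By injectivity the first
    solution is [g]; the second is close to [f] by the power bound at [s], and the Lipschitz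
    estimate makes the two close. Hence [g - f], which is [(s' T)^(2^k) g], is small compared with
    [g]. *)
Lemma pow_bound_step k s s' : 0 <= s <= s' -> 0 < s' <= t ->
  (s' - s) * M ^+ 2 <= 4^-1 ->
  (forall x, s ^+ (2 ^ k) * N (iter (2 ^ k) T x) <= N x / 8) ->
  forall x, s' ^+ (2 ^ k) * N (iter (2 ^ k) T x) <= N x.
Proof.
move=> /andP[s0 ss'] /andP[s'0 s't] small Hs g.
set n := (2 ^ k)%N.
pose f := g - (s'%:C%C) ^+ n *: iter n T g.
have s'n : normc s'%:C%C = s' by rewrite normc_real gtr0_norm.
have [||v [v' [hv hv' b]]] := @resolvent_pow_lipschitz k s'%:C%C (s / s') f.
- by rewrite s'n.
- by rewrite divr_ge0 ?(ltW s'0)//= ler_pdivrMr// mul1r.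
have vg : v = g.
  apply/eqP; rewrite -subr_eq0; apply/eqP.
  apply: (@one_sub_pow_inj k s'%:C%C); first by rewrite s'n.
  rewrite iterTB scalerBr opprB (AC (2*2) ((1*4)*(3*2)))/= hv -opprB.
  by rewrite subrr.
have b' : N (v - v') <= N f / 4.
  apply: (le_trans b); rewrite s'n mulrBl mul1r divfK ?gt_eqF//.
  by rewrite mulrC ler_wpM2l ?bnorm_ge0.
move: hv'; rewrite -rmorphM/= divfK ?gt_eqF// -rmorphXn/= -/n => hv'.
have v'f : N (v' - f) <= N v' / 8.
  rewrite -[in X in N X <= _]hv' opprB addrC subrK bnormZr ger0_norm ?exprn_ge0//.
have v'le : N v' <= N f + N (v' - f).
  by rewrite -[X in N X <= _](subrK f) addrC bnormD.
have := bnorm_dist v v' f; rewrite vg => h.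
have gf : g - f = (s'^+ n)%:C%C *: iter n T g by rewrite /f opprB addrC subrK rmorphXn.
have fle : N f <= N g + N (g - f).
  by rewrite -[X in N X <= _](subKr g) bnormB.
have := bnorm_ge0 g; move: b' h fle; rewrite vg gf bnormZr ger0_norm ?exprn_ge0 ?(ltW s'0)//; lra.
Qed.

End step.

(** Exponents are powers of two because the averaging over roots is done by repeated halving. The
    step above consumes the margin [e = 1/8] and returns [e = 1]. *)
Definition pow_bounded (e s : R) : Prop :=
  exists k, forall x, s ^+ (2 ^ k) * N (iter (2 ^ k) T x) <= e * N x.

(** A smaller radius gains the factor [(s / s')^(2^k) < 1]; composing the bound with itself [2^j]
    times brings this factor below 1/8. *)
Lemma pow_bounded_lt s s' : 0 <= s < s' -> pow_bounded 1 s' -> pow_bounded 8^-1 s.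
Proof.
move=> /andP[s0 ss'] [k hk]; have s'0 := le_lt_trans s0 ss'.
have q01 : 0 <= (s / s') ^+ (2 ^ k) < 1.
  by rewrite exprn_ge0 ?divr_ge0 ?(ltW s'0)// exprn_ilt1 ?divr_ge0 ?(ltW s'0)
    ?ltr_pdivrMr ?mul1r// -lt0n expn_gt0.
have [j hj] : exists j, ((s / s') ^+ (2 ^ k)) ^+ (2 ^ j) <= 8^-1.
  have := @cvg_expr R ((s / s') ^+ (2 ^ k)).
  rewrite ger0_norm; last by case/andP: q01.
  case/andP: q01 => q0 q1 /(_ q1) /cvgrPdist_lt /(_ 8^-1) /(_ ltac:(lra)) [n _ hn].
  exists n; have /ltW := hn (2 ^ n)%N (ltnW (ltn_expl n (ltnSn 1))).
  by rewrite /= sub0r normrN ger0_norm // exprn_ge0.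
exists (k + j)%N => x.
have it m : (s' ^+ (2 ^ k)) ^+ m * N (iter (2 ^ k * m) T x) <= N x.
  elim: m => [|m IH]; first by rewrite muln0 expr0 mul1r.
  rewrite mulnS iterD exprS mulrAC mulrC; apply: le_trans IH.
  rewrite ler_wpM2l ?exprn_ge0 ?(ltW s'0)//.
  by have := hk (iter (2 ^ k * m) T x); rewrite mul1r.
have := it (2 ^ j)%N; rewrite -expnD => h.
have -> : s ^+ (2 ^ (k + j)) = ((s / s') ^+ (2 ^ k)) ^+ (2 ^ j) * (s' ^+ (2 ^ k)) ^+ (2 ^ j).
  by rewrite -!exprM -expnD -exprMn divfK ?gt_eqF.
rewrite -mulrA; apply: ler_pM => //.
- by rewrite !exprn_ge0// divr_ge0// ltW.
- by rewrite mulr_ge0 ?bnorm_ge0// !exprn_ge0// ltW.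
Qed.

(** A bound for the inverse at [l] persists, doubled, in a neighbourhood of [l]; the disc is
    compact. *)
Lemma resolvent_uniformly_bounded t : 0 <= t ->
  (forall l, normc l <= t -> bijective_one_sub l) ->
  exists2 M, 0 < M &
    forall l, normc l <= t -> forall x, N x <= M * N (one_sub l x).
Proof.
move=> t0 bij.
pose D := [set p : R * R | p.1 ^+ 2 + p.2 ^+ 2 <= t ^+ 2].
have DE (p : R * R) : D p <-> normc (p.1 +i* p.2)%C <= t.
  rewrite /D/= -[X in X <-> _]/(is_true _) -(@ler_sqrt _ _ (t ^+ 2)) ?sqr_ge0//.
  by rewrite sqrtr_sqr ger0_norm.
have cD : compact D.
  apply: (@subclosed_compact _ _ (`[- t, t] `*` `[- t, t])).
  - have -> : D = (fun p : R * R => p.1 ^+ 2 + p.2 ^+ 2) @^-1` [set x | x <= t ^+ 2].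
      by [].
    apply: preimage_closed; last exact: closed_le.
    move=> p _; apply: cvgD.
      by apply: (@continuous_comp _ _ _ fst (fun x : R => x ^+ 2));
        [exact: cvg_fst|exact: exprn_continuous].
    by apply: (@continuous_comp _ _ _ snd (fun x : R => x ^+ 2));
      [exact: cvg_snd|exact: exprn_continuous].
  - by apply: compact_setX; exact: segment_compact.
  - move=> [a b]; rewrite /D/= => h; rewrite !in_itv/= -!ler_norml.
    have := sqr_ge0 a; have := sqr_ge0 b => b0 a0.
    split; rewrite -(@ler_pXn2r _ 2) ?nnegrE// real_normK ?num_real//; lra.
(* Compactness is applied along the filter [+oo] in [M], which replaces the maximum over a finite
   subcover. *)
have /compact_near_coveringP := cD.
move=> /(_ R +oo (fun M p => forall x, N x <= M * N (one_sub (p.1 +i* p.2)%C x))).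
case.
  move=> [a b] /DE; rewrite [(a, b).1]/= [(a, b).2]/=; set l : R[i] := (a +i* b)%C => lt.
  have [inj surj] := bij _ lt.
  have [M0 M0p HM0] := @inverse_bounded (one_sub l) _ (one_sub_bounded _) surj inj.
  (* With this radius in each coordinate, [l'] is within [(2 * M0)^-1] of [l], so the perturbation
     costs at most [N x / 2]. *)
  have e0 : 0 < (4 * M0)^-1 by rewrite invr_gt0 mulr_gt0.
  exists (ball (a, b) (4 * M0)^-1, [set M | 2 * M0 < M]).
    by split; [exact: nbhsx_ballx|exists (2 * M0); split; rewrite ?num_real].
  move=> [[a' b'] M] /= [[/= ha hb]] hM x.
  set l' : R[i] := (a' +i* b')%C.
  have ll' : normc (l' - l) <= (2 * M0)^-1.
    apply: (le_trans (normc_le _ _)); rewrite /= (distrC a') (distrC b').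
    have -> : (2 * M0)^-1 = (4 * M0)^-1 + (4 * M0)^-1 by field; rewrite gt_eqF.
    by apply: lerD; apply: ltW.
  have h1 : N (one_sub l x) <= N (one_sub l' x) + (2 * M0)^-1 * N x.
    have -> : one_sub l x = one_sub l' x + (l' - l) *: T x.
      by rewrite /one_sub scalerBl addrA subrK.
    apply: (le_trans (bnormD bN _ _)); rewrite lerD2l bnormZ//.
    by rewrite ler_pM ?normc_ge0 ?bnorm_ge0.
  have h2 : N x <= 2 * M0 * N (one_sub l' x).
    have := HM0 x; have : M0 * N (one_sub l x) <= M0 * (N (one_sub l' x) + (2 * M0)^-1 * N x).
      by rewrite ler_pM2l.
    have -> : M0 * (N (one_sub l' x) + (2 * M0)^-1 * N x) = M0 * N (one_sub l' x) + N x / 2.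
      by field; rewrite gt_eqF.
    lra.
  by apply: (le_trans h2); rewrite ler_wpM2r ?bnorm_ge0// ltW.
move=> M0 [_ hM0].
exists (Num.max 1 (M0 + 1)).
  by rewrite lt_max ltr01.
move=> [a b] lt x.
apply: (hM0 (Num.max 1 (M0 + 1)) _ (a, b)) => //; last exact/DE.
by rewrite lt_max; apply/orP; right; lra.
Qed.

(** Induction on the number of steps of length [d] needed to reach the radius. A single exponent
    suffices here; [sqnorm_iter_conv_op] fills in the others for the convolution operator. *)
Theorem gelfand t s : 0 <= s < t ->
  (forall l, normc l <= t -> bijective_one_sub l) ->
  exists2 n, (0 < n)%N & forall x, s ^+ n * N (iter n T x) <= N x.
Proof.
move=> /andP[s0 st] bij; have t0 := le_lt_trans s0 st.
have [M M0 bndM] := resolvent_uniformly_bounded (ltW t0) bij.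
pose d := (8 * M ^+ 2)^-1.
have d0 : 0 < d by rewrite invr_gt0 mulr_gt0// exprn_gt0.
have dM : d * M ^+ 2 = 8^-1 by rewrite /d; field; rewrite gt_eqF.
have main n r : 0 <= r < t -> r <= n%:R * d -> pow_bounded 8^-1 r.
  elim: n r => [|n IH] r /andP[r0 rt] rn.
    exists 0%N => x; rewrite expn0 expr1 /=; move: rn; rewrite mul0r => rn.
    have -> : r = 0 by apply/eqP; rewrite eq_le rn.
    by rewrite mul0r mulr_ge0 ?bnorm_ge0.
  (* The step is aimed at a radius slightly beyond [r], since coming back to [r] restores the margin
     1/8. The advance from [n d] is at most [3 d / 2], and [(3/2)(1/8) <= 1/4]. *)
  pose r' := Num.min t (r + d / 2).
  have [rnd|rnd] := leP r (n%:R * d); first by apply: IH => //; rewrite r0.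
  have r'1 : r < r' by rewrite lt_min rt; lra.
  have r't : r' <= t by rewrite ge_min lexx.
  have r'2 : r' <= r + d / 2 by rewrite ge_min lexx orbT.
  apply: (@pow_bounded_lt _ r'); first by rewrite r0.
  have nd0 : 0 <= n%:R * d by rewrite mulr_ge0// ltW.
  have [|k hk] := IH (n%:R * d) _ (lexx _).
    by rewrite nd0 (lt_trans rnd).
  exists k => x; rewrite mul1r.
  apply: (@pow_bound_step t M M0 bij bndM k (n%:R * d)).
  - by rewrite nd0/=; lra.
  - by rewrite r't andbT; lra.
  - have : (r' - n%:R * d) * M ^+ 2 <= (d + d / 2) * M ^+ 2.
      rewrite ler_wpM2r ?sqr_ge0//; move: rn; rewrite -natr1 mulrDl mul1r; lra.
    have : (d + d / 2) * M ^+ 2 = 3 / 16 by rewrite mulrDl mulrAC dM; lra.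
    lra.
  - by move=> y; rewrite [N y / 8]mulrC; exact: hk.
have [k hk] : pow_bounded 8^-1 s.
  apply: (main (Num.bound (s / d))); first by rewrite s0.
  by rewrite -ler_pdivrMr// ltW// archi_boundP// divr_ge0// ltW.
exists (2 ^ k)%N; first by rewrite expn_gt0.
by move=> x; apply: (le_trans (hk x)); rewrite ler_piMl ?bnorm_ge0//; lra.
Qed.

End gelfand.
End banach.

(** * Complete seminorms *)

Section seminorm.
Context (R : realType) (E : lmodType R[i]) (p : E -> R).

(** Square-integrable functions are not identified almost everywhere, so they carry only a seminorm;
    the Banach space results reach it through the quotient by [null_vectors]. *)
Record complete_seminorm : Prop := CompleteSeminorm {
  csnormD : forall x y, p (x + y) <= p x + p y ;
  csnormZ : forall z x, p (z *: x) = normc z * p x ;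
  csnorm_complete : forall u : nat -> E,
    (forall n, p (u n.+1 - u n) <= 2^-1 ^+ n) ->
    exists l, forall n, p (u n - l) <= 4 * 2^-1 ^+ n }.

Local Open Scope quotient_scope.

Hypothesis sp : complete_seminorm.

Lemma csnorm0 : p 0 = 0.
Proof. by rewrite -(scale0r 0) csnormZ// normc0 mul0r. Qed.

Lemma csnormN x : p (- x) = p x.
Proof. by rewrite -scaleN1r csnormZ// normcN1 mul1r. Qed.

Lemma csnorm_ge0 x : 0 <= p x.
Proof. have := csnormD sp x (- x); rewrite subrr csnorm0 csnormN; lra. Qed.

Definition null_vectors : {pred E} := [pred x | p x == 0].

Fact null_vectors_zmod_closed : zmod_closed null_vectors.
Proof.
split=> [|x y]; rewrite !inE ?csnorm0// => /eqP x0 /eqP y0.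
rewrite eq_le csnorm_ge0 andbT.
by have := csnormD sp x (- y); rewrite csnormN x0 y0 addr0.
Qed.

HB.instance Definition _ := GRing.isZmodClosed.Build E null_vectors
  null_vectors_zmod_closed.

Local Notation Q := (Quotient.quot null_vectors).
Let cls (x : E) : Q := \pi_Q x.

Lemma clsP x y : cls x = cls y <-> p (x - y) = 0.
Proof.
rewrite /cls; split => [/eqP|h]; last apply/eqP; rewrite -Quotient.idealrBE inE.
  by move/eqP.
by rewrite h.
Qed.

Let clsD x y : cls (x + y) = cls x + cls y.
Proof. by rewrite /cls raddfD. Qed.

Let clsB x y : cls (x - y) = cls x - cls y.
Proof. by rewrite /cls raddfB. Qed.

Let clsK q : cls (repr q) = q. Proof. exact: reprK. Qed.

Let qscale (a : R[i]) (q : Q) : Q := cls (a *: repr q).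

Let qscaleE a x : qscale a (cls x) = cls (a *: x).
Proof.
apply/clsP; rewrite -scalerBr csnormZ//.
by have /clsP -> := clsK (cls x); rewrite mulr0.
Qed.

Let qscaleA a b q : qscale a (qscale b q) = qscale (a * b) q.
Proof. by rewrite -[q]clsK !qscaleE scalerA. Qed.
Let qscale1 : left_id 1 qscale.
Proof. by move=> q; rewrite -[q]clsK qscaleE scale1r. Qed.
Let qscaleDr : right_distributive qscale +%R.
Proof. by move=> a q r; rewrite -[q]clsK -[r]clsK -clsD !qscaleE scalerDr clsD. Qed.
Let qscaleDl q : {morph qscale^~ q : a b / a + b}.
Proof. by move=> a b; rewrite -[q]clsK !qscaleE scalerDl clsD. Qed.

HB.instance Definition _ := GRing.Zmodule_isLmodule.Build R[i] Q
  qscaleA qscale1 qscaleDr qscaleDl.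

Let clsZ (a : R[i]) x : cls (a *: x) = a *: cls x.
Proof. by rewrite -qscaleE. Qed.

Let qnorm (q : Q) := p (repr q).

Let qnormE x : qnorm (cls x) = p x.
Proof.
have /clsP h := clsK (cls x); rewrite /qnorm; apply/eqP; rewrite eq_le.
have h1 := csnormD sp (repr (cls x) - x) x; have h2 := csnormD sp (x - repr (cls x)) (repr (cls x)).
move: h1 h2; rewrite !subrK -[p (x - _)]csnormN opprB h; lra.
Qed.

Let qnorm_banach : banach_norm qnorm.
Proof.
split=> [x y|z x|x|u hu].
- by rewrite -[x]clsK -[y]clsK -clsD !qnormE csnormD.
- by rewrite -[x]clsK -clsZ !qnormE csnormZ.
- by rewrite -[x]clsK qnormE => h; rewrite -(raddf0 \pi_Q); apply/clsP; rewrite subr0.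
- have [n|l hl] := csnorm_complete sp (u := repr \o u).
    by have := hu n; rewrite -[u n.+1]clsK -[u n]clsK -clsB qnormE.
  exists (cls l) => n; rewrite -[u n]clsK -clsB qnormE; exact: hl.
Qed.

Section operator.
Variable T : E -> E.
Hypothesis T_linear : forall a x y, p (T (a *: x + y) - (a *: T x + T y)) = 0.
Hypothesis T1 : forall x, p (T x) <= p x.

Let qT (q : Q) : Q := cls (T (repr q)).

(** [T] is linear only up to null vectors; with the contraction bound this still lets it descend to
    the quotient. *)
Let TE x y : p (x - y) = 0 -> cls (T x) = cls (T y).
Proof.
move=> h; apply/clsP; apply/eqP; rewrite eq_le csnorm_ge0 andbT.
have e : p (T (x - y) - (T x - T y)) = 0.
  have /clsP := T_linear (-1) y x; rewrite !scaleN1r clsD addrC [in RHS]addrC -clsD => h'.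
  by apply/clsP; rewrite h'; congr cls; rewrite addrC.
have := csnormD sp (T (x - y)) (- (T (x - y) - (T x - T y))).
by rewrite subKr csnormN e addr0 => /le_trans; apply; rewrite -h T1.
Qed.

Let qTE x : qT (cls x) = cls (T x).
Proof. by apply: TE; apply/clsP; rewrite clsK. Qed.

Let qT_linear : linear qT.
Proof.
move=> a x y; rewrite -[x]clsK -[y]clsK -clsZ -clsD !qTE -clsZ -clsD.
exact/clsP.
Qed.

HB.instance Definition _ := GRing.isLinear.Build R[i] Q Q *:%R qT qT_linear.

Let qT1 q : qnorm (qT q) <= qnorm q.
Proof. by rewrite -[q]clsK qTE !qnormE. Qed.

Definition seminorm_bijective_one_sub (l : R[i]) :=
  (forall x, p (x - l *: T x) = 0 -> p x = 0) /\
  (forall y, exists x, p (x - l *: T x - y) = 0).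

Let bijP l : bijective_one_sub qT l <-> seminorm_bijective_one_sub l.
Proof.
have e x : one_sub qT l (cls x) = cls (x - l *: T x).
  by rewrite /one_sub -[X in _ - _ *: X]/(qT (cls x)) qTE clsB clsZ.
have c0 x : cls x = 0 <-> p x = 0.
  by rewrite -(raddf0 \pi_Q); split => [/clsP|h]; [|apply/clsP]; rewrite subr0.
split=> -[inj surj]; split.
- by move=> x h; apply/c0/inj; rewrite e; apply/c0.
- move=> y; have [x] := surj (cls y); rewrite -[x]clsK e => /clsP h.
  by exists (repr x).
- by move=> q; rewrite -[q]clsK e => /c0 h; apply/c0/inj.
- move=> q; have [x h] := surj (repr q); exists (cls x).
  by rewrite e -[RHS]clsK; apply/clsP.
Qed.

Lemma seminorm_small_resolvent l : normc l <= 2^-1 -> seminorm_bijective_one_sub l.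
Proof. by move=> l2; apply/bijP/(small_resolvent_bijective qnorm_banach qT1). Qed.

Lemma seminorm_gelfand t s : 0 <= s < t ->
  (forall l, normc l <= t -> seminorm_bijective_one_sub l) ->
  exists2 n, (0 < n)%N & forall x, s ^+ n * p (iter n T x) <= p x.
Proof.
move=> st bij.
have [|n n0 h] := gelfand qnorm_banach qT1 st; first by move=> l /bij /bijP.
exists n => // x.
have it m y : iter m qT (cls y) = cls (iter m T y).
  by elim: m => [//|m IH] /=; rewrite IH qTE.
by have := h (cls x); rewrite it !qnormE.
Qed.

End operator.
End seminorm.

(** * Square-integrable functions *)

Section real_integrable.
Context (R : realType) (d : measure_display) (X : measurableType d).
Variable m : {measure set X -> \bar R}.
Implicit Types f g : X -> R.

Lemma integrable_addr f g : m.-integrable setT (EFin \o f) ->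
  m.-integrable setT (EFin \o g) -> m.-integrable setT (EFin \o (fun x => f x + g x)).
Proof. exact: integrableD. Qed.

Lemma integrable_mulr c f : m.-integrable setT (EFin \o f) ->
  m.-integrable setT (EFin \o (fun x => c * f x)).
Proof. exact: integrableZl. Qed.

End real_integrable.

Section lebesgue2.
Context (R : realType) (d : measure_display) (X : measurableType d).
Variable m : probability X R.
Implicit Types f g : X -> R.

Lemma limn_einf_le_cst (u : (\bar R)^nat) c : (forall n, u n <= c)%E -> (limn_einf u <= c)%E.
Proof.
move=> uc; rewrite limn_einf_lim; apply: lime_le; first exact: is_cvg_einfs.
apply: nearW => n; apply: le_trans (uc n).
by apply: ereal_inf_lbound; exists n => /=.
Qed.

(** The series of [h n / s^n] has integral at most a convergent geometric series, so it is finite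
    almost everywhere; its sum at [x] serves as [K]. *)
Lemma ae_geometric_bound (h : nat -> X -> R) (C r s : R) :
  (forall n, measurable_fun setT (h n)) -> (forall n x, 0 <= h n x) ->
  0 <= C -> 0 <= r < s ->
  (forall n, (\int[m]_x (h n x)%:E <= (C * r ^+ n)%:E)%E) ->
  \forall x \ae m, exists2 K, 0 <= K & forall n, h n x <= K * s ^+ n.
Proof.
move=> mh h0 C0 /andP[r0 rs] hle; have s0 := le_lt_trans r0 rs.
pose k n x : \bar R := (h n x / s ^+ n)%:E.
have mk n : measurable_fun setT (k n).
  by apply/measurable_EFinP; apply: measurable_funM => //; exact: measurable_cst.
have k0 n x : (0 <= k n x)%E by rewrite lee_fin divr_ge0// exprn_ge0// ltW.
have ik n : (\int[m]_x k n x <= (geometric C (r / s) n)%:E)%E.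
  have -> : (\int[m]_x k n x = (s ^+ n)^-1%:E * \int[m]_x (h n x)%:E)%E.
    rewrite -ge0_integralZl//.
    - by apply: eq_integral => x _; rewrite /k mulrC EFinM.
    - exact/measurable_EFinP.
    - by move=> x _; rewrite lee_fin.
    - by rewrite lee_fin invr_ge0 exprn_ge0// ltW.
  rewrite (@le_trans _ _ ((s ^+ n)^-1%:E * (C * r ^+ n)%:E)%E)//.
    by rewrite lee_wpmul2l// lee_fin invr_ge0 exprn_ge0// ltW.
  by rewrite -EFinM lee_fin /= expr_div_n mulrC mulrA.
have q1 : `|r / s| < 1 by rewrite ger0_norm ?divr_ge0 ?(ltW s0)// ltr_pdivrMr ?mul1r.
pose F x : \bar R := (\sum_(0 <= n <oo) k n x)%E.
have iF : m.-integrable setT F.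
  apply/integrableP; split.
    by apply: ge0_emeasurable_sum => // n x _ _; exact: k0.
  under eq_integral do rewrite gee0_abs ?nneseries_ge0//.
  rewrite integral_nneseries//.
  apply: (@le_lt_trans _ _ (\sum_(0 <= n <oo) (geometric C (r / s) n)%:E)%E).
    by apply: lee_nneseries => // n _ _; apply: integral_ge0.
  have g0 n : 0 <= geometric C (r / s) n.
    by rewrite /= mulr_ge0// exprn_ge0// divr_ge0// ltW.
  rewrite (_ : (fun n => _) = EFin \o (series (geometric C (r / s)))); last first.
    by apply/funext => n /=; rewrite sumEFin.
  by rewrite EFin_lim ?ltry//; exact: is_cvg_geometric_series.
have := integrable_ae measurableT iF; apply: filterS => x /(_ I) Fx.
exists (fine (F x)); first by rewrite fine_ge0// nneseries_ge0.
move=> n; rewrite -ler_pdivrMr ?exprn_gt0// -lee_fin fineK//.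
have -> : (h n x / s ^+ n)%:E = k n x by [].
rewrite /F (@nneseriesD1 _ (k ^~ x) n)// ?leeDl//.
by apply: nneseries_ge0.
Qed.

Lemma L2_sqr_integrable f : L2 m f -> m.-integrable setT (EFin \o (fun x => f x ^+ 2)).
Proof.
move=> [mf f2]; apply/integrableP; split.
  by apply/measurable_EFinP; exact: measurable_funX.
by under eq_integral do rewrite /= ger0_norm ?sqr_ge0//.
Qed.

Lemma L2_le f g : measurable_fun setT f -> L2 m g ->
  (forall x, f x ^+ 2 <= g x ^+ 2) -> L2 m f.
Proof.
move=> mf [mg g2] fg; split => //; apply: le_lt_trans g2.
apply: ge0_le_integral => //.
- by move=> x _; rewrite lee_fin sqr_ge0.
- by apply/measurable_EFinP; exact: measurable_funX.
- by apply/measurable_EFinP; exact: measurable_funX.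
- by move=> x _; rewrite lee_fin.
Qed.

Lemma L2_of_integrable f : measurable_fun setT f ->
  m.-integrable setT (EFin \o (fun x => f x ^+ 2)) -> L2 m f.
Proof. by move=> mf /(integrable_lty measurableT). Qed.

Lemma L2_lin a b f g : L2 m f -> L2 m g -> L2 m (fun x => a * f x + b * g x).
Proof.
move=> Lf Lg; have [mf _] := Lf; have [mg _] := Lg.
have mfg : measurable_fun setT (fun x => a * f x + b * g x).
  by apply: measurable_funD; apply: measurable_funM.
apply: L2_of_integrable => //.
apply: (@le_integrable _ _ _ _ _ _ _
  (EFin \o (fun x => 2 * a ^+ 2 * f x ^+ 2 + 2 * b ^+ 2 * g x ^+ 2))) => //.
- by apply/measurable_EFinP; exact: measurable_funX.
- move=> x _; rewrite /= lee_fin ger0_norm ?sqr_ge0//; apply: le_trans (ler_norm _).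
  have := sqr_ge0 (a * f x - b * g x); nra.
- by apply: integrable_addr; apply: integrable_mulr; exact: L2_sqr_integrable.
Qed.

Lemma L2B f g : L2 m f -> L2 m g -> L2 m (fun x => f x - g x).
Proof.
move=> Lf Lg; have := L2_lin 1 (-1) Lf Lg.
by congr L2; apply/funext => x; rewrite mul1r mulN1r.
Qed.

Lemma L2_cst c : L2 m (fun=> c).
Proof.
split; first exact: measurable_cst.
by rewrite integral_cst// [X in (_ * X)%E](probability_setT m) mule1 ltry.
Qed.

(** On a probability space the bound [|f| <= f^2 + 1] suffices. *)
Lemma L2_integrable f : L2 m f -> m.-integrable setT (EFin \o f).
Proof.
move=> Lf; have [mf _] := Lf.
apply: (@le_integrable _ _ _ _ _ _ _ (EFin \o (fun x => f x ^+ 2 + 1 ^+ 2))) => //.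
- exact/measurable_EFinP.
- move=> x _; rewrite /= lee_fin [leRHS]ger0_norm ?addr_ge0 ?sqr_ge0//.
  have := sqr_ge0 (`|f x| - 1); rewrite -(real_normK (num_real (f x))).
  have := normr_ge0 (f x); nra.
- apply: integrable_addr; first exact: L2_sqr_integrable.
  exact: (L2_sqr_integrable (L2_cst 1)).
Qed.

Lemma L2_0_lin a b f g : L2_0 m f -> L2_0 m g -> L2_0 m (fun x => a * f x + b * g x).
Proof.
move=> [Lf f0] [Lg g0]; split; first exact: L2_lin.
rewrite RintegralD//.
- by rewrite !RintegralZl ?f0 ?g0 ?mulr0 ?addr0//; exact: L2_integrable.
- by apply: integrable_mulr; exact: L2_integrable.
- by apply: integrable_mulr; exact: L2_integrable.
Qed.

Definition sqnorm f : R := \int[m]_x (f x ^+ 2).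

Lemma sqnorm_ge0 f : 0 <= sqnorm f.
Proof. by apply: Rintegral_ge0 => x _; rewrite sqr_ge0. Qed.

Lemma sqnormE f : L2 m f -> (\int[m]_x (f x ^+ 2)%:E = (sqnorm f)%:E)%E.
Proof.
move=> /L2_sqr_integrable i; rewrite /sqnorm /Rintegral fineK//.
exact: (integrable_fin_num measurableT i).
Qed.

Lemma sqnorm_le c f : 0 <= c -> (\int[m]_x (f x ^+ 2)%:E <= c%:E)%E -> sqnorm f <= c.
Proof.
move=> c0 h; rewrite -lee_fin /sqnorm /Rintegral fineK// ge0_fin_numE.
  exact: (le_lt_trans h (ltry _)).
by apply: integral_ge0 => x _; rewrite lee_fin sqr_ge0.
Qed.

(** A weighted form of [2uv <= u^2 + v^2]. Optimising over [th] in [sqrt_triangle] gives Minkowski's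
    inequality. *)
Lemma sqnorm_lin_le a b f g : L2 m f -> L2 m g ->
  forall th, 0 < th -> sqnorm (fun x => a * f x + b * g x) <=
    (1 + th) * (a ^+ 2 * sqnorm f) + (1 + th^-1) * (b ^+ 2 * sqnorm g).
Proof.
move=> Lf Lg th th0; rewrite /sqnorm !mulrA -!RintegralZl//; last 2 first.
- exact: L2_sqr_integrable.
- exact: L2_sqr_integrable.
rewrite -RintegralD//; last 2 first.
- by apply: integrable_mulr; exact: L2_sqr_integrable.
- by apply: integrable_mulr; exact: L2_sqr_integrable.
apply: le_Rintegral => //.
- by apply: L2_sqr_integrable; exact: L2_lin.
- by apply: integrable_addr; apply: integrable_mulr; exact: L2_sqr_integrable.
- move=> x _; set u := a * f x; set v := b * g x.
  have -> : (1 + th) * a * a * f x ^+ 2 + (1 + th^-1) * b * b * g x ^+ 2 =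
    (u + v) ^+ 2 + th^-1 * (th * u - v) ^+ 2.
    by rewrite /u /v; field; rewrite gt_eqF.
  by rewrite lerDl mulr_ge0 ?sqr_ge0// invr_ge0 ltW.
Qed.

Lemma sqrt_triangle (A B C : R) : 0 <= A -> 0 <= B ->
  (forall th, 0 < th -> C <= (1 + th) * A + (1 + th^-1) * B) ->
  Num.sqrt C <= Num.sqrt A + Num.sqrt B.
Proof.
move=> A0 B0 H; apply/ler_addgt0Pr => e e0.
(* The optimal [th] is the ratio of the two square roots; adding [e / 2] to each keeps it positive
   and well defined. *)
pose a := Num.sqrt A + e / 2; pose b := Num.sqrt B + e / 2.
have sA := sqrtr_ge0 A; have sB := sqrtr_ge0 B.
have a0 : 0 < a by rewrite /a; lra.
have b0 : 0 < b by rewrite /b; lra.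
have -> : Num.sqrt A + Num.sqrt B + e = a + b by rewrite /a /b; lra.
rewrite -[leRHS]ger0_norm; last by lra.
rewrite -sqrtr_sqr ler_wsqrtr//.
apply: (le_trans (H (b / a) (divr_gt0 b0 a0))).
have Aa : A <= a ^+ 2 by rewrite -{1}(sqr_sqrtr A0) ler_pXn2r ?nnegrE//; rewrite /a; lra.
have Bb : B <= b ^+ 2 by rewrite -{1}(sqr_sqrtr B0) ler_pXn2r ?nnegrE//; rewrite /b; lra.
have -> : (a + b) ^+ 2 = (1 + b / a) * a ^+ 2 + (1 + (b / a)^-1) * b ^+ 2.
  by field; rewrite !gt_eqF.
by apply: lerD; rewrite ler_pM2l// addr_gt0// ?invr_gt0 divr_gt0.
Qed.

Lemma sqnormD_sqrt f g : L2 m f -> L2 m g ->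
  Num.sqrt (sqnorm (fun x => f x + g x)) <= Num.sqrt (sqnorm f) + Num.sqrt (sqnorm g).
Proof.
move=> Lf Lg; apply: sqrt_triangle; rewrite ?sqnorm_ge0// => th th0.
have := @sqnorm_lin_le 1 1 _ _ Lf Lg th th0; rewrite expr1n !mul1r.
by under [in sqnorm _]eq_fun do rewrite !mul1r.
Qed.

(** The variance of [f] is nonnegative. *)
Lemma sqr_Rintegral_le f : L2 m f -> (\int[m]_x f x)%R ^+ 2 <= sqnorm f.
Proof.
move=> Lf; set c := (\int[m]_x f x)%R.
have h : 0 <= sqnorm (fun x => f x - c) by exact: sqnorm_ge0.
have e : sqnorm (fun x => f x - c) = sqnorm f - c ^+ 2.
  have -> : sqnorm (fun x => f x - c) =
      (\int[m]_x (f x ^+ 2 + (- (2 * c)) * f x + c ^+ 2))%R.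
    by apply: eq_Rintegral => x _; ring.
  have i1 := L2_sqr_integrable Lf.
  have i2 : m.-integrable setT (EFin \o (fun x => - (2 * c) * f x)).
    by apply: integrable_mulr; exact: L2_integrable.
  have i3 : m.-integrable setT (EFin \o (fun=> c ^+ 2)).
    exact: (L2_integrable (L2_cst (c ^+ 2))).
  rewrite RintegralD//; last exact: integrable_addr.
  rewrite RintegralD// RintegralZl//; last exact: L2_integrable.
  rewrite Rintegral_cst// [X in c ^+ 2 * fine X]probability_setT /= -/c -/(sqnorm f); ring.
lra.
Qed.

End lebesgue2.

(** * Completeness of the space of square-integrable functions *)

Section riesz_fischer.
Context (R : realType) (d : measure_display) (X : measurableType d).
Variable m : probability X R.

Lemma cvgn_of_geometric (u : nat -> R) (K q : R) : 0 <= q < 1 ->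
  (forall n, `|u n.+1 - u n| <= K * q ^+ n) -> cvgn u.
Proof.
move=> /andP[q0 q1] h.
have -> : u = (fun n => u 0%N + series (telescope u) n).
  by apply/funext => n; exact: eq_sum_telescope.
apply: is_cvgD; first exact: is_cvg_cst.
apply: normed_cvg; apply: (@series_le_cvg _ _ (geometric K q)) => //.
- by move=> n; exact: normr_ge0.
- by move=> n; exact: (le_trans (normr_ge0 _) (h n)).
- by apply: is_cvg_geometric_series; rewrite ger0_norm.
Qed.

(** Almost everywhere the increments decay geometrically, which gives a pointwise limit; Fatou's
    lemma bounds the distance to it. *)
Lemma L2_complete (f : nat -> X -> R) :
  (forall n, L2 m (f n)) ->
  (forall n, Num.sqrt (sqnorm m (fun x => f n.+1 x - f n x)) <= 2^-1 ^+ n) ->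
  exists2 g, L2 m g &
    forall n, Num.sqrt (sqnorm m (fun x => f n x - g x)) <= 2 * 2^-1 ^+ n.
Proof.
move=> Lf fS.
have LB i j : L2 m (fun x => f i x - f j x) by exact: L2B.
have fS2 n : sqnorm m (fun x => f n.+1 x - f n x) <= 4^-1 ^+ n.
  have -> : 4^-1 ^+ n = (2^-1 ^+ n) ^+ 2 :> R.
    by rewrite -exprM mulnC exprM; congr (_ ^+ n); field.
  by rewrite -[leLHS]sqr_sqrtr ?sqnorm_ge0// ler_pXn2r ?nnegrE ?sqrtr_ge0 ?exprn_ge0.
have ae_cvg : \forall x \ae m, cvgn (f ^~ x).
  (* The squared increments have integrals at most [4^-n]; any ratio strictly between 1/2 and 1
     would do in place of 3/4. *)
  have q := @ae_geometric_bound R d X m (fun n x => (f n.+1 x - f n x) ^+ 2) 1 4^-1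
    ((3 / 4) ^+ 2) _ _ ler01 _ _.
  apply: filterS (q _ _ _ _) => [x [K K0 hK]|n|n x||n].
  - apply: (@cvgn_of_geometric _ (Num.sqrt K) (3 / 4)).
      by apply/andP; split; lra.
    move=> n; rewrite -(@ler_pXn2r _ 2) ?nnegrE ?mulr_ge0 ?sqrtr_ge0 ?exprn_ge0//.
    by rewrite real_normK ?num_real// exprMn sqr_sqrtr// -exprM mulnC exprM.
  - by apply: measurable_funX; have [] := LB n.+1 n.
  - exact: sqr_ge0.
  - by apply/andP; split; lra.
  - by rewrite mul1r sqnormE// lee_fin.
(* The upper limit is measurable on all of [X], and [fine] replaces infinite values by 0. *)
pose g x := fine (limn_esup (fun n => (f n x)%:E)).
have mg : measurable_fun setT g.
  apply: (measurableT_comp (fine_measurable measurableT)).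
  apply: measurable_fun_limn_esup => n; apply/measurable_EFinP.
  by have [] := Lf n.
have ae_g : \forall x \ae m, f n x @[n --> \oo] --> g x.
  apply: filterS ae_cvg => x /cvg_ex[l fl].
  have e : (f n x)%:E @[n --> \oo] --> l%:E by apply/cvg_EFin; [exact: nearW|exact: fl].
  by rewrite /g (cvg_limn_einf_sup e).2.
have step n k : Num.sqrt (sqnorm m (fun x => f n x - f (n + k)%N x)) <= 2 * 2^-1 ^+ n.
  (* The subtracted term is the rest of the geometric series, which makes the induction on [k]
     close. *)
  suff : Num.sqrt (sqnorm m (fun x => f n x - f (n + k)%N x)) <=
      2 * 2^-1 ^+ n - 2 * 2^-1 ^+ (n + k).
    by move=> /le_trans; apply; rewrite gerBl mulr_ge0// exprn_ge0.
  elim: k => [|k IH].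
    rewrite addn0 subrr (_ : (fun x => _) = (fun=> 0)); last by apply/funext => x; rewrite subrr.
    rewrite /sqnorm; under eq_Rintegral do rewrite expr0n.
    by rewrite Rintegral_cst// mul0r sqrtr0.
  have -> : (fun x => f n x - f (n + k.+1)%N x) =
      (fun x => (f n x - f (n + k)%N x) + - (f (n + k).+1 x - f (n + k)%N x)).
    by apply/funext => x; rewrite addnS; ring.
  have LN : L2 m (fun x => - (f (n + k).+1 x - f (n + k)%N x)).
    have := L2B (L2_cst m 0) (LB (n + k).+1 (n + k)%N).
    by congr L2; apply/funext => x; rewrite sub0r.
  apply: (le_trans (sqnormD_sqrt (LB _ _) LN)).
  have -> : sqnorm m (fun x => - (f (n + k).+1 x - f (n + k)%N x)) =
      sqnorm m (fun x => f (n + k).+1 x - f (n + k)%N x).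
    by apply: eq_Rintegral => x _; rewrite sqrrN.
  by have := fS (n + k)%N; move: IH; rewrite addnS exprS; lra.
have fatou_bound n : (\int[m]_x ((f n x - g x) ^+ 2)%:E <= ((2 * 2^-1 ^+ n) ^+ 2)%:E)%E.
  pose h k x : \bar R := ((f n x - f (k + n)%N x) ^+ 2)%:E.
  have mh k : measurable_fun setT (h k).
    by apply/measurable_EFinP; apply: measurable_funX; have [] := LB n (k + n)%N.
  have -> : (\int[m]_x ((f n x - g x) ^+ 2)%:E = \int[m]_x limn_einf (h ^~ x))%E.
    apply: ae_eq_integral => //.
    - apply/measurable_EFinP; apply: measurable_funX; apply: measurable_funB => //.
      by have [] := Lf n.
    - have -> : (fun x => limn_einf (h ^~ x)) =
          (fun x => - limn_esup (fun k => - h k x))%E.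
        by apply/funext => x; rewrite -[in RHS]limn_einfN; congr limn_einf;
          apply/funext => k; rewrite /comp oppeK.
      apply: measurableT_comp => //; apply: measurable_fun_limn_esup => k.
      exact: measurableT_comp.
    - apply: filterS ae_g => x fg _.
      suff e : h k x @[k --> \oo] --> ((f n x - g x) ^+ 2)%:E.
        by rewrite (cvg_limn_einf_sup e).1.
      apply/cvg_EFin; first exact: nearW.
      have fg2 : (f n x - f (k + n)%N x) @[k --> \oo] --> f n x - g x.
        by apply: cvgB; [exact: cvg_cst|rewrite (cvg_shiftn n (f ^~ x))].
      exact: (cvgM fg2 fg2).
  apply: (le_trans (fatou m measurableT mh _)).
    by move=> k x _; rewrite lee_fin sqr_ge0.
  apply: limn_einf_le_cst => k; rewrite /h sqnormE// lee_fin addnC.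
  by rewrite -[leLHS]sqr_sqrtr ?sqnorm_ge0// ler_pXn2r ?nnegrE ?sqrtr_ge0 ?mulr_ge0 ?exprn_ge0.
have Lfg n : L2 m (fun x => f n x - g x).
  split; last exact: (le_lt_trans (fatou_bound n) (ltry _)).
  by apply: measurable_funB => //; have [] := Lf n.
exists g.
  have := L2B (Lf 0%N) (Lfg 0%N).
  by congr L2; apply/funext => x; rewrite subKr.
move=> n; rewrite -[leRHS]ger0_norm ?mulr_ge0 ?exprn_ge0// -sqrtr_sqr ler_wsqrtr//.
by apply: sqnorm_le; rewrite ?sqr_ge0.
Qed.

End riesz_fischer.

(** * Complexification of the mean-zero functions, and the spectral radius *)

Section complexification.
Context (R : realType) (d : measure_display) (X : measurableType d).
Variable m : probability X R.
Implicit Types f g : X -> R.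

Lemma sqnorm_eq0 f : L2 m f -> sqnorm m f = 0 <-> aeeq m f (fun=> 0).
Proof.
move=> Lf; have [mf _] := Lf.
have mf2 : measurable_fun setT (fun x => (f x ^+ 2)%:E).
  by apply/measurable_EFinP; exact: measurable_funX.
have e : (\int[m]_x `|(f x ^+ 2)%:E| = (sqnorm m f)%:E)%E.
  by rewrite -sqnormE//; apply: eq_integral => x _; rewrite gee0_abs// lee_fin sqr_ge0.
split=> [h|h].
  have /(ae_eq_integral_abs _ measurableT mf2) : (\int[m]_x `|(f x ^+ 2)%:E| = 0)%E.
    by rewrite e h.
  by apply: filterS => x /(_ I) [] /eqP; rewrite sqrf_eq0 => /eqP.
have [] : (sqnorm m f)%:E = 0%E; last by [].
rewrite -e; apply/(ae_eq_integral_abs _ measurableT mf2).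
by apply: filterS h => x fx _; rewrite fx expr0n.
Qed.

Local Notation Re := complex.Re.
Local Notation Im := complex.Im.

Definition complex_L2_0 : {pred (X -> R[i])} := fun h =>
  `[< L2_0 m (fun x => Re (h x)) /\ L2_0 m (fun x => Im (h x)) >].

Lemma complex_L2_0P h : reflect
  (L2_0 m (fun x => Re (h x)) /\ L2_0 m (fun x => Im (h x))) (h \in complex_L2_0).
Proof. exact: asboolP. Qed.

Lemma L2_0_cst0 : L2_0 m (fun=> 0).
Proof. by split; [exact: L2_cst|rewrite Rintegral_cst// mul0r]. Qed.

Fact complex_L2_0_submod_closed : submod_closed complex_L2_0.
Proof.
split=> [|a u v /complex_L2_0P[ru iu] /complex_L2_0P[rv iv]].
  by apply/complex_L2_0P; split; exact: L2_0_cst0.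
apply/complex_L2_0P; split.
- have := L2_0_lin 1 1 (L2_0_lin (Re a) (- Im a) ru iu) rv.
  congr L2_0; apply/funext => x; rewrite !fctE /=.
  by case: (a) (u x) (v x) => [? ?] [? ?] [? ?] /=; ring.
- have := L2_0_lin 1 1 (L2_0_lin (Im a) (Re a) ru iu) iv.
  congr L2_0; apply/funext => x; rewrite !fctE /=.
  by case: (a) (u x) (v x) => [? ?] [? ?] [? ?] /=; ring.
Qed.

HB.instance Definition _ := GRing.isSubmodClosed.Build _ _ complex_L2_0
  complex_L2_0_submod_closed.

Record cL2 := CL2 { cL2_val :> X -> R[i]; _ : cL2_val \in complex_L2_0 }.
HB.instance Definition _ := [isSub for cL2_val].
HB.instance Definition _ := [Choice of cL2 by <:].
HB.instance Definition _ := [SubChoice_isSubLmodule of cL2 by <:].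

Implicit Types h k : cL2.

Lemma cL2_re h : L2_0 m (fun x => Re (h x)).
Proof. by have /complex_L2_0P[] := valP h. Qed.

Lemma cL2_im h : L2_0 m (fun x => Im (h x)).
Proof. by have /complex_L2_0P[] := valP h. Qed.

Lemma mk_cL2_subproof f g : L2_0 m f -> L2_0 m g ->
  (fun x => (f x +i* g x)%C) \in complex_L2_0.
Proof. by move=> Lf Lg; apply/complex_L2_0P. Qed.

Definition mk_cL2 f g (Lf : L2_0 m f) (Lg : L2_0 m g) : cL2 :=
  CL2 (mk_cL2_subproof Lf Lg).

Definition cnorm h : R :=
  Num.sqrt (sqnorm m (fun x => Re (h x)) + sqnorm m (fun x => Im (h x))).

Lemma Re_sub h k x : Re ((h - k) x) = Re (h x) - Re (k x).
Proof. by rewrite -[(h - k) x]/(h x - k x); case: (h x) (k x) => [? ?] [? ?]. Qed.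

Lemma Im_sub h k x : Im ((h - k) x) = Im (h x) - Im (k x).
Proof. by rewrite -[(h - k) x]/(h x - k x); case: (h x) (k x) => [? ?] [? ?]. Qed.

Lemma Re_scale z h x : Re ((z *: h) x) = Re z * Re (h x) - Im z * Im (h x).
Proof. by rewrite -[(z *: h) x]/(z * h x); case: z (h x) => [? ?] [? ?]. Qed.

Lemma Im_scale z h x : Im ((z *: h) x) = Im z * Re (h x) + Re z * Im (h x).
Proof.
by rewrite -[(z *: h) x]/(z * h x); case: z (h x) => [? ?] [? ?] /=; rewrite addrC.
Qed.

Lemma cnorm_eq0 h : cnorm h = 0 <->
  aeeq m (fun x => Re (h x)) (fun=> 0) /\ aeeq m (fun x => Im (h x)) (fun=> 0).
Proof.
rewrite -sqnorm_eq0; last by case: (cL2_re h).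
rewrite -sqnorm_eq0; last by case: (cL2_im h).
rewrite /cnorm; split=> [/eqP|[-> ->]]; last by rewrite addr0 sqrtr0.
rewrite sqrtr_eq0 => s0.
have := sqnorm_ge0 m (fun x => Re (h x)); have := sqnorm_ge0 m (fun x => Im (h x)).
by split; lra.
Qed.

Lemma cnorm_complete_seminorm : complete_seminorm cnorm.
Proof.
split=> [h k|z h|u hu].
- apply: sqrt_triangle; rewrite ?addr_ge0 ?sqnorm_ge0// => th th0.
  have re : sqnorm m (fun x => Re ((h + k) x)) <= (1 + th) * sqnorm m (fun x => Re (h x)) +
      (1 + th^-1) * sqnorm m (fun x => Re (k x)).
    have := @sqnorm_lin_le _ _ _ m 1 1 _ _ (cL2_re h).1 (cL2_re k).1 th th0.
    rewrite expr1n !mul1r; apply: le_trans; rewrite le_eqVlt; apply/orP; left; apply/eqP.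
    apply: eq_Rintegral => x _; rewrite !mul1r -[(h + k) x]/(h x + k x).
    by case: (h x) (k x) => [? ?] [? ?].
  have im : sqnorm m (fun x => Im ((h + k) x)) <= (1 + th) * sqnorm m (fun x => Im (h x)) +
      (1 + th^-1) * sqnorm m (fun x => Im (k x)).
    have := @sqnorm_lin_le _ _ _ m 1 1 _ _ (cL2_im h).1 (cL2_im k).1 th th0.
    rewrite expr1n !mul1r; apply: le_trans; rewrite le_eqVlt; apply/orP; left; apply/eqP.
    apply: eq_Rintegral => x _; rewrite !mul1r -[(h + k) x]/(h x + k x).
    by case: (h x) (k x) => [? ?] [? ?].
  by move: re im; rewrite !mulrDr; lra.
- have sre := L2_sqr_integrable (cL2_re h).1.
  have sim := L2_sqr_integrable (cL2_im h).1.
  have -> : normc z = Num.sqrt (Re z ^+ 2 + Im z ^+ 2) by case: z.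
  rewrite /cnorm -sqrtrM ?addr_ge0 ?sqr_ge0//; congr Num.sqrt.
  rewrite /sqnorm -!RintegralD//; last 2 first.
  + by apply: L2_sqr_integrable; have [] := cL2_re (z *: h).
  + by apply: L2_sqr_integrable; have [] := cL2_im (z *: h).
  rewrite -RintegralZl//; last exact: integrable_addr.
  by apply: eq_Rintegral => x _; rewrite Re_scale Im_scale; ring.
- have ru n : Num.sqrt (sqnorm m (fun x => Re (u n.+1 x) - Re (u n x))) <= 2^-1 ^+ n.
    apply: le_trans (hu n); rewrite ler_wsqrtr//.
    under eq_fun do rewrite -Re_sub.
    by rewrite lerDl sqnorm_ge0.
  have iu n : Num.sqrt (sqnorm m (fun x => Im (u n.+1 x) - Im (u n x))) <= 2^-1 ^+ n.
    apply: le_trans (hu n); rewrite ler_wsqrtr//.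
    under eq_fun do rewrite -Im_sub.
    by rewrite lerDr sqnorm_ge0.
  (* Mean zero passes to the limit because the mean is bounded by the norm. *)
  have mean0 (f : nat -> X -> R) g : (forall n, L2_0 m (f n)) -> L2 m g ->
      (forall n, Num.sqrt (sqnorm m (fun x => f n x - g x)) <= 2 * 2^-1 ^+ n) -> L2_0 m g.
    move=> Lf Lg fg; split => //; apply/eqP; rewrite -normr_eq0 eq_le normr_ge0 andbT.
    apply: (@le_of_half_pow _ _ _ 2 0) => n _; rewrite add0r; apply: le_trans (fg n).
    have [Lfn fn0] := Lf n.
    rewrite -sqrtr_sqr ler_wsqrtr//; apply: le_trans (sqr_Rintegral_le (L2B Lfn Lg)).
    rewrite RintegralB//; [|exact: L2_integrable|exact: L2_integrable].
    by rewrite fn0 sub0r sqrrN.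
  have [gr Lgr hgr] := L2_complete (fun n => (cL2_re (u n)).1) ru.
  have [gi Lgi hgi] := L2_complete (fun n => (cL2_im (u n)).1) iu.
  exists (mk_cL2 (mean0 _ _ (fun n => cL2_re (u n)) Lgr hgr)
                 (mean0 _ _ (fun n => cL2_im (u n)) Lgi hgi)) => n.
  have sqrtD (A B : R) : 0 <= A -> 0 <= B -> Num.sqrt (A + B) <= Num.sqrt A + Num.sqrt B.
    move=> A0 B0; apply: sqrt_triangle => // th th0.
    have ti0 : 0 <= th^-1 by rewrite invr_ge0 ltW.
    have := mulr_ge0 (ltW th0) A0; have := mulr_ge0 ti0 B0; lra.
  apply: (le_trans (sqrtD _ _ (sqnorm_ge0 _ _) (sqnorm_ge0 _ _))).
  under eq_fun do rewrite Re_sub.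
  under [X in _ + Num.sqrt (sqnorm _ X)]eq_fun do rewrite Im_sub.
  by have := hgr n; have := hgi n; rewrite /=; lra.
Qed.

Section operator.
Variable T : (X -> R) -> X -> R.
Hypothesis T_L2_0 : forall f, L2_0 m f -> L2_0 m (T f).
Hypothesis T_lin : forall a b f g, L2_0 m f -> L2_0 m g ->
  aeeq m (T (fun x => a * f x + b * g x)) (fun x => a * T f x + b * T g x).
Hypothesis T_contr : forall f, L2_0 m f -> sqnorm m (T f) <= sqnorm m f.

Definition complex_op h : cL2 := mk_cL2 (T_L2_0 (cL2_re h)) (T_L2_0 (cL2_im h)).

Lemma complex_op_contr h : cnorm (complex_op h) <= cnorm h.
Proof.
rewrite ler_wsqrtr//; apply: lerD; apply: T_contr; [exact: cL2_re|exact: cL2_im].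
Qed.

Lemma cnorm_aeeq h k : aeeq m (fun x => Re (h x)) (fun x => Re (k x)) ->
  aeeq m (fun x => Im (h x)) (fun x => Im (k x)) -> cnorm (h - k) = 0.
Proof.
move=> re im; apply/cnorm_eq0; split.
- by apply: filterS re => x e; rewrite Re_sub e subrr.
- by apply: filterS im => x e; rewrite Im_sub e subrr.
Qed.

Lemma complex_op_lin z h k :
  cnorm (complex_op (z *: h + k) - (z *: complex_op h + complex_op k)) = 0.
Proof.
have Radd h1 h2 x : Re ((h1 + h2) x) = Re (h1 x) + Re (h2 x).
  by rewrite -[(h1 + h2) x]/(h1 x + h2 x); case: (h1 x) (h2 x) => [? ?] [? ?].
have Iadd h1 h2 x : Im ((h1 + h2) x) = Im (h1 x) + Im (h2 x).
  by rewrite -[(h1 + h2) x]/(h1 x + h2 x); case: (h1 x) (h2 x) => [? ?] [? ?].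
have lin3 a b f1 f2 f3 : L2_0 m f1 -> L2_0 m f2 -> L2_0 m f3 ->
    aeeq m (T (fun x => a * f1 x + b * f2 x + f3 x))
      (fun x => a * T f1 x + b * T f2 x + T f3 x).
  move=> L1 L2' L3.
  have := T_lin 1 1 (L2_0_lin a b L1 L2') L3.
  have -> : (fun x => 1 * (a * f1 x + b * f2 x) + 1 * f3 x) =
    (fun x => a * f1 x + b * f2 x + f3 x) by apply/funext => x; rewrite !mul1r.
  by apply: filterS2 (T_lin a b L1 L2') => x e ->; rewrite e !mul1r.
apply: cnorm_aeeq.
- have -> : (fun x => Re (complex_op (z *: h + k) x)) =
      T (fun x => Re z * Re (h x) + (- Im z) * Im (h x) + Re (k x)).
    transitivity (T (fun x => Re ((z *: h + k) x))) => //.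
    by congr T; apply/funext => x; rewrite Radd Re_scale; ring.
  apply: filterS (lin3 (Re z) (- Im z) _ _ _ (cL2_re h) (cL2_im h) (cL2_re k)) => x ->.
  by rewrite Radd Re_scale /=; ring.
- have -> : (fun x => Im (complex_op (z *: h + k) x)) =
      T (fun x => Im z * Re (h x) + Re z * Im (h x) + Im (k x)).
    transitivity (T (fun x => Im ((z *: h + k) x))) => //.
    by congr T; apply/funext => x; rewrite Iadd Im_scale.
  apply: filterS (lin3 (Im z) (Re z) _ _ _ (cL2_re h) (cL2_im h) (cL2_im k)) => x ->.
  by rewrite Iadd Im_scale.
Qed.

(** The two real equations of [in_resolvent] are the real and imaginary parts of one complex
    equation. *)
Lemma in_resolvent_bijective a b : in_resolvent m T a b <->
  (forall h, cnorm (complex_op h - (a +i* b)%C *: h) = 0 -> cnorm h = 0) /\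
  (forall k, exists h, cnorm (complex_op h - (a +i* b)%C *: h - k) = 0).
Proof.
have reE h x : Re ((complex_op h - (a +i* b)%C *: h) x) =
    T (fun x => Re (h x)) x - a * Re (h x) + b * Im (h x).
  by rewrite Re_sub Re_scale /=; ring.
have imE h x : Im ((complex_op h - (a +i* b)%C *: h) x) =
    T (fun x => Im (h x)) x - a * Im (h x) - b * Re (h x).
  by rewrite Im_sub Im_scale /=; ring.
split=> -[inj surj]; split.
- move=> h /cnorm_eq0[re im]; apply/cnorm_eq0; apply: inj.
  + exact: cL2_re.
  + exact: cL2_im.
  + by apply: filterS re => x; rewrite reE.
  + by apply: filterS im => x; rewrite imE.
- move=> k; have [u [v [Lu Lv re im]]] := surj _ _ (cL2_re k) (cL2_im k).
  exists (mk_cL2 Lu Lv); apply: cnorm_aeeq.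
  + by apply: filterS re => x; rewrite reE.
  + by apply: filterS im => x; rewrite imE.
- move=> u v Lu Lv re im; apply/(cnorm_eq0 (mk_cL2 Lu Lv))/inj/cnorm_eq0; split.
  + by apply: filterS re => x; rewrite reE.
  + by apply: filterS im => x; rewrite imE.
- move=> p q Lp Lq; have [h /cnorm_eq0[re im]] := surj (mk_cL2 Lp Lq).
  exists (fun x => Re (h x)), (fun x => Im (h x)); split.
  + exact: cL2_re.
  + exact: cL2_im.
  + by apply: filterS re => x; rewrite Re_sub reE => /eqP; rewrite subr_eq0 => /eqP.
  + by apply: filterS im => x; rewrite Im_sub imE => /eqP; rewrite subr_eq0 => /eqP.
Qed.

Local Notation sp := cnorm_complete_seminorm.

(** [T - z] equals [-z (1 - z^-1 T)], and multiplication by [-z] preserves and reflects null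
    vectors. *)
Lemma in_resolvent_inv a b : (a +i* b)%C != 0 :> R[i] ->
  in_resolvent m T a b <-> seminorm_bijective_one_sub (@cnorm) complex_op (a +i* b)%C^-1.
Proof.
set z := (a +i* b)%C => z0.
have nz : normc z != 0 by apply: contra_neq z0; exact: eq0_normc.
have e h : complex_op h - z *: h = - z *: (h - z^-1 *: complex_op h).
  by rewrite scalerBr scalerA mulNr divff// scaleN1r opprK scaleNr addrC.
have cZ1 x : cnorm (- z *: x) = 0 -> cnorm x = 0.
  rewrite scaleNr (csnormN sp) (csnormZ sp) => /eqP.
  by rewrite mulf_eq0 (negPf nz) => /eqP.
have cZ2 x : cnorm x = 0 -> cnorm (- z *: x) = 0.
  by rewrite scaleNr (csnormN sp) (csnormZ sp) => ->; rewrite mulr0.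
rewrite in_resolvent_bijective -/z; split=> -[inj surj]; split.
- by move=> h h0; apply: inj; rewrite e; exact: cZ2.
- move=> k; have [h hk] := surj (- z *: k); exists h.
  by apply: cZ1; rewrite scalerBr -e.
- by move=> h h0; apply: inj; apply: cZ1; rewrite -e.
- move=> k; have [h hk] := surj (- z^-1 *: k); exists h.
  have := cZ2 _ hk; rewrite [X in cnorm X]scalerBr -e scalerA mulrNN divff//.
  by rewrite scale1r.
Qed.

Let spectrum := [set r | exists a b, ~ in_resolvent m T a b /\ r = Num.sqrt (a ^+ 2 + b ^+ 2)].

(** Boundedness makes the supremum a genuine upper bound. The value 2 comes from the radius 1/2 of
    the Neumann series. *)
Lemma spectrum_ubound : ubound spectrum 2.
Proof.
move=> _ [a [b [nr ->]]]; rewrite leNgt; apply/negP => ab2; apply: nr.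
have nz : normc (a +i* b)%C = Num.sqrt (a ^+ 2 + b ^+ 2) by [].
apply/in_resolvent_inv.
  by apply: contraTneq ab2 => z0; rewrite -nz z0 normc0 -leNgt.
apply: (seminorm_small_resolvent sp complex_op_lin complex_op_contr).
by rewrite normcV nz lef_pV2 ?posrE ?ltW//; apply: lt_trans ab2.
Qed.

Lemma spectral_radius_ge0 : 0 <= spectral_radius m T.
Proof.
have [[r sr]|/set0P/negP/negPn/eqP s0] := pselect (spectrum !=set0).
  apply: (@le_trans _ _ r); last first.
    by apply: ub_le_sup => //; exists 2; exact: spectrum_ubound.
  by have [a [b [_ ->]]] := sr; rewrite sqrtr_ge0.
(* For an empty spectrum [sup] takes its default value 0. *)
by rewrite /spectral_radius -/spectrum s0 sup0.
Qed.

Lemma gt_spectral_radius_resolvent a b :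
  spectral_radius m T < Num.sqrt (a ^+ 2 + b ^+ 2) -> in_resolvent m T a b.
Proof.
move=> h; apply: contrapT => nr; move: h; rewrite ltNge => /negP; apply.
by apply: ub_le_sup; [exists 2; exact: spectrum_ubound|exists a, b].
Qed.

Theorem spectral_radius_growth r : spectral_radius m T < r ->
  exists2 n, (0 < n)%N & forall f, L2_0 m f ->
    sqnorm m (iter n T f) <= (r ^+ n) ^+ 2 * sqnorm m f.
Proof.
set rho := spectral_radius m T => rr.
have rho0 : 0 <= rho := spectral_radius_ge0.
have r0 := le_lt_trans rho0 rr.
(* [t^-1] is the midpoint of [rho] and [r]: thus [r^-1 < t], and [|l| <= t] with [l] nonzero forces
   [|l^-1| > rho]. *)
pose t := 2 / (rho + r).
have rrho : 0 < rho + r by rewrite ltr_wpDl.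
have st : 0 <= r^-1 < t.
  rewrite invr_ge0 (ltW r0)/= /t ltr_pdivlMr// mulrDr mulVf ?gt_eqF//.
  have : r^-1 * rho < 1 by rewrite mulrC ltr_pdivrMr ?mul1r.
  lra.
have [l lt|n n0 hn] := seminorm_gelfand sp complex_op_lin complex_op_contr st.
  have [->|l0] := eqVneq l 0.
    apply: (seminorm_small_resolvent sp complex_op_lin complex_op_contr).
    by rewrite normc0 invr_ge0.
  have nl0 : 0 < normc l.
    by rewrite lt_neqAle normc_ge0 andbT eq_sym; apply: contra_neq l0; exact: eq0_normc.
  case e : (l^-1) => [a b].
  have lE : l = (a +i* b)%C^-1 by rewrite -e invrK.
  rewrite lE; apply/in_resolvent_inv; first by rewrite -e invr_eq0.
  apply: gt_spectral_radius_resolvent.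
  have -> : Num.sqrt (a ^+ 2 + b ^+ 2) = normc l^-1 by rewrite e.
  rewrite normcV -/rho; apply: (@lt_le_trans _ _ t^-1); last by rewrite lef_pV2 ?posrE// divr_gt0.
  by rewrite /t invf_div; lra.
exists n => // f Lf.
(* A real function is viewed as a complex one with zero imaginary part, on which the complexified
   operator acts as [T]. *)
have h0 : L2_0 m (fun=> 0 : R) by exact: L2_0_cst0.
have itre j : forall x, Re (iter j complex_op (mk_cL2 Lf h0) x) = iter j T f x.
  suff : (fun x => Re (iter j complex_op (mk_cL2 Lf h0) x)) = iter j T f by move=> <-.
  by elim: j => [//|j IH]; rewrite /= -IH.
have := hn (mk_cL2 Lf h0); rewrite /cnorm.
under eq_fun do rewrite itre.
rewrite [X in _ <= Num.sqrt (_ + X)](_ : _ = 0) ?addr0; last first.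
  by rewrite /sqnorm /=; under eq_Rintegral do rewrite expr0n; rewrite Rintegral_cst// mul0r.
rewrite exprVn -ler_pdivlMl ?invr_gt0 ?exprn_gt0// invrK => h.
have h2 : Num.sqrt (sqnorm m (iter n T f)) <= r ^+ n * Num.sqrt (sqnorm m f).
  by apply: le_trans h; rewrite ler_wsqrtr// lerDl sqnorm_ge0.
have := h2; rewrite -(@ler_pXn2r _ 2) ?nnegrE ?mulr_ge0 ?sqrtr_ge0 ?exprn_ge0 ?(ltW r0)//.
by rewrite exprMn !sqr_sqrtr ?sqnorm_ge0.
Qed.

End operator.
End complexification.

(** * The convolution operator *)

Lemma integrable_fubini_G (R : realType) (d1 d2 : measure_display)
    (T1 : measurableType d1) (T2 : measurableType d2)
    (m1 : {sigma_finite_measure set T1 -> \bar R})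
    (m2 : {sigma_finite_measure set T2 -> \bar R}) (f : T1 * T2 -> \bar R) :
  (m1 \x m2)%E.-integrable setT f -> m2.-integrable setT (fubini_G m1 f).
Proof.
move=> fi; have mf := measurable_int _ fi.
have mG := measurable_fubini_G fi.
have maf : measurable_fun setT (abse \o f) by exact: measurableT_comp.
apply/integrableP; split => //.
move/(integrable21ltyP _ _ mf) : fi; apply: le_lt_trans.
apply: ge0_le_integral => //.
- exact: measurableT_comp.
- by apply: (@measurable_fun_fubini_tonelli_G _ _ _ _ _ m1 (abse \o f)) => // p; exact: abse_ge0.
- move=> y _; apply: le_abse_integral => //.
  exact: (measurableT_comp mf (pair2_measurable y)).
Qed.

Section convolution.
Context (R : realType) (dG dX : measure_display)
  (G : measurableType dG) (X : measurableType dX) (act : G -> X -> X).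
Variables (mX : probability X R) (mu : probability G R).
Hypothesis mact : measurable_fun setT (fun p : G * X => act p.1 p.2).
Hypothesis inv : invariant_measure act mX.
Implicit Types (f : X -> R) (F : X -> \bar R).

Let uact (p : G * X) := act p.1 p.2.

HB.instance Definition _ := isMeasurableFun.Build _ _ _ _ uact mact.

Let mact1 g : measurable_fun setT (act g).
Proof. exact: (measurableT_comp mact (pair1_measurable g)). Qed.

Let mact2 x : measurable_fun setT (act ^~ x).
Proof. exact: (measurableT_comp mact (pair2_measurable x)). Qed.

(** The convolution operator on extended nonnegative functions, where Tonelli's theorem asks for no
    integrability; integrability statements for [conv_op] are derived from it. *)
Definition avg F (x : X) : \bar R := (\int[mu]_g F (act g x))%E.

Lemma avg_ge0 F : (forall x, 0 <= F x)%E -> forall x, (0 <= avg F x)%E.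
Proof. by move=> F0 x; apply: integral_ge0. Qed.

Lemma measurable_avg F : measurable_fun setT F -> (forall x, 0 <= F x)%E ->
  measurable_fun setT (avg F).
Proof.
move=> mF F0.
apply: (@measurable_fun_fubini_tonelli_G _ _ _ _ _ mu (F \o uact)).
- exact: measurableT_comp.
- by move=> p; exact: F0.
Qed.

Lemma integral_act g F : measurable_fun setT F -> (forall x, 0 <= F x)%E ->
  (\int[mX]_x F (act g x) = \int[mX]_x F x)%E.
Proof.
move=> mF F0.
have -> : (\int[mX]_x F x = \int[pushforward mX (act g)]_x F x)%E.
  by apply: eq_measure_integral => A mA _; exact/esym/inv.
by rewrite ge0_integral_pushforward.
Qed.

Lemma integral_avg F : measurable_fun setT F -> (forall x, 0 <= F x)%E ->
  (\int[mX]_x avg F x = \int[mX]_x F x)%E.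
Proof.
move=> mF F0.
have mFu : measurable_fun setT (F \o uact) by exact: measurableT_comp.
rewrite -(@fubini_tonelli _ _ _ _ _ mu mX (F \o uact) mFu (fun=> F0 _)).
transitivity (\int[mu]_g \int[mX]_x F x)%E.
  by apply: eq_integral => g _; exact: integral_act.
by rewrite integral_cst// [X in (_ * X)%E]probability_setT mule1.
Qed.

(** [conv_orbit] is a bare set function; the integration lemmas need it as a measure. *)
Lemma conv_orbit_probability n x :
  exists P : probability X R, conv_orbit act mu n x = P.
Proof.
elim: n => [|n [P hP]]; first by exists (\d_x).
by exists (distribution (mu \x P)%E uact); rewrite /= hP.
Qed.

Lemma conv_orbitS n x (P : probability X R) : conv_orbit act mu n x = P ->
  conv_orbit act mu n.+1 x = distribution (mu \x P)%E uact.
Proof. by move=> /= ->. Qed.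

(** Integrating out the group element that acts last replaces [F] by [avg F], so the induction
    varies [F]. *)
Lemma integral_conv_orbit n x F : measurable_fun setT F -> (forall x, 0 <= F x)%E ->
  (\int[conv_orbit act mu n x]_y F y = iter n avg F x)%E.
Proof.
elim: n F => [|n IH] F mF F0.
  by rewrite /= integral_dirac// diracT mul1e.
have [P hP] := conv_orbit_probability n x.
rewrite (conv_orbitS hP) ge0_integral_distribution//.
rewrite (@fubini_tonelli2 _ _ _ _ _ mu P (F \o uact) _ (fun=> F0 _)); last exact: measurableT_comp.
rewrite iterSr -IH ?hP//; first exact: measurable_avg.
exact: avg_ge0.
Qed.

Lemma iter_avg n F : measurable_fun setT F -> (forall x, 0 <= F x)%E ->
  [/\ measurable_fun setT (iter n avg F), forall x, (0 <= iter n avg F x)%E &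
      (\int[mX]_x iter n avg F x = \int[mX]_x F x)%E].
Proof.
move=> mF F0; elim: n => [//|n [m0 p0 e]]; split => /=.
- exact: measurable_avg.
- exact: avg_ge0.
- by rewrite integral_avg.
Qed.

(** Invariance gives all iterated averages of [|f|] the integral of [|f|], so they are finite almost
    everywhere, for countably many [n] at once. *)
Lemma ae_integrable_conv_orbit f : mX.-integrable setT (EFin \o f) ->
  \forall x \ae mX, forall n, (conv_orbit act mu n x).-integrable setT (EFin \o f).
Proof.
move=> fi; have mf := measurable_int _ fi.
apply: ae_foralln => n.
have mF : measurable_fun setT (fun x => `|(f x)%:E|)%E by exact: measurableT_comp.
have F0 x : (0 <= `|(f x)%:E|)%E by [].
have [mI I0 eI] := iter_avg n mF F0.
have iI : mX.-integrable setT (iter n avg (fun x => `|(f x)%:E|%E)).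
  apply/integrableP; split => //; under eq_integral do rewrite gee0_abs//.
  by rewrite eI; case/integrableP : fi.
apply: filterS (integrable_ae measurableT iI) => x /(_ I) Ix.
apply/integrableP; split => //.
by rewrite integral_conv_orbit// -ge0_fin_numE.
Qed.

Lemma ae_integrable_orbit_map f : mX.-integrable setT (EFin \o f) ->
  \forall x \ae mX, mu.-integrable setT (EFin \o (fun g => f (act g x))).
Proof.
move=> fi; have /measurable_EFinP mf := measurable_int _ fi.
have mF : measurable_fun setT (fun x => `|(f x)%:E|)%E.
  by apply: measurableT_comp => //; exact/measurable_EFinP.
have [mI I0 eI] := iter_avg 1 mF (fun x => abse_ge0 _).
have iI : mX.-integrable setT (avg (fun x => `|(f x)%:E|%E)).
  apply/integrableP; split => //; under eq_integral do rewrite gee0_abs ?(I0 _)//.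
  by rewrite [X in (X < _)%E]eI; case/integrableP : fi.
apply: filterS (integrable_ae measurableT iI) => x /(_ I) Ix.
apply/integrableP; split; last by rewrite -ge0_fin_numE//; exact: I0.
by apply/measurable_EFinP; exact: measurableT_comp.
Qed.

Local Notation T := (conv_op act mu).

Lemma measurable_conv_op f : measurable_fun setT f -> measurable_fun setT (T f).
Proof.
move=> mf; have mE : measurable_fun setT (EFin \o f) by exact/measurable_EFinP.
(* Positive and negative parts are averaged separately, so that Tonelli's theorem gives
   measurability in [x]. *)
have -> : T f = fine \o (fun x => avg (EFin \o f)^\+ x - avg (EFin \o f)^\- x)%E.
  apply/funext => x; rewrite /conv_op /Rintegral integralE.
  by congr (fine (_ - _)%E); apply: eq_integral => g _; rewrite ?funeposE ?funenegE.
apply: (measurableT_comp (fine_measurable measurableT)); apply: emeasurable_funB.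
- by apply: measurable_avg => //; exact: measurable_funepos.
- by apply: measurable_avg => //; exact: measurable_funeneg.
Qed.

(** This is [sqr_Rintegral_le] along the orbit map when the right side is finite, and trivial
    otherwise. *)
Lemma conv_op_sqr_le f x : measurable_fun setT f ->
  (((T f x) ^+ 2)%:E <= avg (fun y => (f y ^+ 2)%:E) x)%E.
Proof.
move=> mf; have [lt|] := ltP (avg (fun y => (f y ^+ 2)%:E) x) +oo%E; last first.
  by rewrite leye_eq => /eqP ->; rewrite leey.
have Lf : L2 mu (fun g => f (act g x)) by split => //; exact: measurableT_comp.
by rewrite /avg sqnormE// lee_fin; exact: sqr_Rintegral_le.
Qed.

Lemma conv_op_sqr_integral f : L2 mX f ->
  (\int[mX]_x ((T f x) ^+ 2)%:E <= \int[mX]_x (f x ^+ 2)%:E)%E.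
Proof.
move=> [mf _].
have m2 : measurable_fun setT (fun y => (f y ^+ 2)%:E).
  by apply/measurable_EFinP; exact: measurable_funX.
have p2 y : (0 <= (f y ^+ 2)%:E)%E by rewrite lee_fin sqr_ge0.
rewrite -(integral_avg m2 p2); apply: ge0_le_integral => //.
- by move=> x _; rewrite lee_fin sqr_ge0.
- by apply/measurable_EFinP; apply: measurable_funX; exact: measurable_conv_op.
- exact: measurable_avg.
- by move=> x _; exact: conv_op_sqr_le.
Qed.

Lemma L2_conv_op f : L2 mX f -> L2 mX (T f).
Proof.
move=> Lf; have [mf f2] := Lf; split; first exact: measurable_conv_op.
exact: le_lt_trans (conv_op_sqr_integral Lf) f2.
Qed.

Lemma sqnorm_conv_op f : L2 mX f -> sqnorm mX (T f) <= sqnorm mX f.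
Proof.
move=> Lf; rewrite -lee_fin -!sqnormE//; first exact: conv_op_sqr_integral.
exact: L2_conv_op.
Qed.

(** [conv_op] takes the real part [fine] of Fubini's inner integral, which changes it only where it
    is infinite, on a null set. *)
Lemma integral_conv_op (P : probability X R) f :
  (mu \x P)%E.-integrable setT (EFin \o (f \o uact)) ->
  (\int[P]_y (T f y)%:E = \int[mu \x P]_p (f (uact p))%:E)%E.
Proof.
move=> fi; rewrite -(integral21_prod_meas1 fi).
have iG := integrable_fubini_G fi.
apply: ae_eq_integral => //.
- apply/measurable_EFinP.
  apply: (measurableT_comp (fine_measurable measurableT)).
  exact: measurable_int iG.
- exact: measurable_int iG.
- apply: filterS (integrable_ae measurableT iG) => y /(_ I) h _.
  by rewrite /conv_op /Rintegral fineK.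
Qed.

Lemma Rintegral_conv_op f : L2 mX f -> (\int[mX]_x T f x = \int[mX]_x f x)%R.
Proof.
move=> Lf; have fi := L2_integrable Lf; have [mf _] := Lf.
have mfu : measurable_fun setT (f \o uact) by exact: measurableT_comp.
have i : (mu \x mX)%E.-integrable setT (EFin \o (f \o uact)).
  apply/integrable21ltyP; first exact/measurable_EFinP.
  have mF : measurable_fun setT (fun x => `|(f x)%:E|)%E.
    by apply: measurableT_comp => //; exact/measurable_EFinP.
  have := integral_avg mF (fun x => abse_ge0 _); rewrite /avg /= => ->.
  by case/integrableP : fi.
rewrite /Rintegral integral_conv_op// -(integral12_prod_meas1 i) /fubini_F/=.
congr fine; rewrite -[RHS]mule1 -(probability_setT mu) -integral_cst//.
apply: eq_integral => g _ /=.
have ig : mX.-integrable setT (EFin \o (f \o act g)).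
  apply/integrableP; split.
    by apply/measurable_EFinP; exact: measurableT_comp.
  have mF : measurable_fun setT (fun x => `|(f x)%:E|)%E.
    by apply: measurableT_comp => //; exact/measurable_EFinP.
  by rewrite (integral_act g mF)//; case/integrableP : fi.
have -> : (\int[mX]_x (f x)%:E = \int[pushforward mX (act g)]_x (f x)%:E)%E.
  by apply: eq_measure_integral => A mA _; exact/esym/inv.
by rewrite integral_pushforward//; exact/measurable_EFinP.
Qed.

(** Additivity is obtained at the points whose orbit maps are integrable, which is almost every
    point. *)
Lemma conv_op_lin a b f g : L2 mX f -> L2 mX g ->
  aeeq mX (T (fun x => a * f x + b * g x)) (fun x => a * T f x + b * T g x).
Proof.
move=> Lf Lg.
apply: filterS2 (ae_integrable_orbit_map (L2_integrable Lf))
  (ae_integrable_orbit_map (L2_integrable Lg)) => x fi gi.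
rewrite /conv_op RintegralD//; [|exact: integrable_mulr|exact: integrable_mulr].
by rewrite !RintegralZl.
Qed.

Lemma L2_0_conv_op f : L2_0 mX f -> L2_0 mX (T f).
Proof. by move=> [Lf f0]; split; [exact: L2_conv_op|rewrite Rintegral_conv_op]. Qed.

(** Fubini's theorem trades one convolution step for one application of [T], so the induction passes
    from [f] to [T f]. *)
Lemma ae_integral_conv_orbit f : L2 mX f -> \forall x \ae mX, forall n,
  (\int[conv_orbit act mu n x]_y (f y)%:E = (iter n T f x)%:E)%E.
Proof.
move=> Lf0; apply: ae_foralln => n; elim: n f Lf0 => [|n IH] f Lf.
  apply: aeW => x /=; rewrite integral_dirac ?diracT ?mul1e//.
  by apply/measurable_EFinP; have [] := Lf.
apply: filterS2 (IH _ (L2_conv_op Lf)) (ae_integrable_conv_orbit (L2_integrable Lf)).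
move=> x hx /(_ n.+1) ix; have [mf _] := Lf.
rewrite iterSr -hx.
have [P hP] := conv_orbit_probability n x.
have iu : (mu \x P)%E.-integrable setT (EFin \o (f \o uact)).
  move: ix; rewrite (conv_orbitS hP) => /integrableP[mE h]; apply/integrableP; split.
    by apply/measurable_EFinP; exact: measurableT_comp.
  by move: h; rewrite ge0_integral_distribution//; exact: measurableT_comp.
rewrite (conv_orbitS hP) integral_distribution//; last exact/measurable_EFinP.
by rewrite hP integral_conv_op.
Qed.

End convolution.

(** * Exponential rates along almost every orbit *)

Section rate.
Context (R : realType).

Lemma limn_esup_root_le (a : nat -> R) (K r s : R) : (forall n, 0 <= a n) ->
  0 <= K -> 0 <= r < s -> (forall n, a n <= K * r ^+ n) ->
  (limn_esup (fun n : nat => (a n `^ n%:R^-1)%:E) <= s%:E)%E.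
Proof.
move=> a0 K0 /andP[r0 rs] ha; have s0 := le_lt_trans r0 rs.
have q1 : `|r / s| < 1 by rewrite ger0_norm ?divr_ge0 ?(ltW s0)// ltr_pdivrMr ?mul1r.
have /cvgrPdist_lt /(_ 1 ltr01) [n0 _ hn0] := @cvg_geometric R K _ q1.
(* Here [K (r / s)^n < 1], that is [K r^n < s^n]; the condition [1 <= n] makes the exponent [1/n]
   meaningful. *)
have small n : (maxn n0 1 <= n)%N -> a n `^ n%:R^-1 <= s.
  rewrite geq_max => /andP[n0n n1].
  have an : a n <= s ^+ n.
    apply: (le_trans (ha n)).
    have := hn0 n n0n; rewrite /= sub0r normrN ger0_norm; last first.
      by rewrite mulr_ge0// exprn_ge0// divr_ge0// ltW.
    by rewrite expr_div_n mulrA ltr_pdivrMr ?exprn_gt0// mul1r => /ltW.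
  apply: (@le_trans _ _ ((s ^+ n) `^ n%:R^-1)).
    by apply: ge0_ler_powR => //; rewrite ?nnegrE ?invr_ge0// exprn_ge0// ltW.
  by rewrite -powR_mulrn ?(ltW s0)// -powRrM mulfV ?pnatr_eq0 -?lt0n// powRr1// ltW.
rewrite limn_esup_lim; apply: lime_le; first exact: is_cvg_esups.
exists (maxn n0 1) => // n hn; apply: ub_ereal_sup => _ [k /= nk <-].
by rewrite lee_fin; apply: small; exact: leq_trans nk.
Qed.

End rate.

Section convolution_rate.
Context (R : realType) (dG dX : measure_display)
  (G : measurableType dG) (X : measurableType dX) (act : G -> X -> X).
Variables (mX : probability X R) (mu : probability G R).
Hypothesis mact : measurable_fun setT (fun p : G * X => act p.1 p.2).
Hypothesis inv : invariant_measure act mX.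

Local Notation T := (conv_op act mu).
Local Notation rho := (spectral_radius mX T).

Lemma conv_op_spectral_radius_ge0 : 0 <= rho.
Proof.
apply: spectral_radius_ge0 => [f|a b f g [Lf _] [Lg _]|f [Lf _]].
- exact: L2_0_conv_op.
- exact: conv_op_lin.
- exact: sqnorm_conv_op.
Qed.

Lemma L2_0_iter_conv_op n f : L2_0 mX f -> L2_0 mX (iter n T f).
Proof. by move=> Lf; elim: n => [//|n IH] /=; exact: L2_0_conv_op. Qed.

(** The growth bound at one exponent [n] is iterated over the multiples of [n]; contraction handles
    the remainder of [k] modulo [n]. *)
Lemma sqnorm_iter_conv_op r : rho < r -> exists2 C, 0 <= C &
  forall k f, L2_0 mX f -> sqnorm mX (iter k T f) <= C * sqnorm mX f * (r ^+ 2) ^+ k.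
Proof.
move=> rr; have r0 := le_lt_trans conv_op_spectral_radius_ge0 rr.
have r0' := ltW r0.
have [f|a b f g [Lf _] [Lg _]|f [Lf _]|n n0 hn] := @spectral_radius_growth _ _ _ _ T _ _ _ _ rr.
- exact: L2_0_conv_op.
- exact: conv_op_lin.
- exact: sqnorm_conv_op.
(* Both [b] and [b r^2] are at least 1, so [b^n] compensates the missing factor
   [(r^2)^(k mod n)]. *)
pose b := 1 + (r ^+ 2)^-1.
have r2 : 0 < r ^+ 2 by rewrite exprn_gt0.
have b1 : 1 <= b by rewrite lerDl invr_ge0 ltW.
exists (b ^+ n); first by rewrite exprn_ge0// (le_trans ler01).
move=> k f Lf.
have contr j : sqnorm mX (iter j T f) <= sqnorm mX f.
  elim: j => [//|j IH]; apply: le_trans IH => /=; apply: sqnorm_conv_op => //.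
  by have [] := L2_0_iter_conv_op j Lf.
have iq q g : L2_0 mX g -> sqnorm mX (iter (q * n) T g) <= (r ^+ 2) ^+ (n * q) * sqnorm mX g.
  move=> Lg; elim: q => [|q IH]; first by rewrite muln0 expr0 mul1r.
  rewrite mulSn iterD mulnS exprD -mulrA.
  apply: (le_trans (hn _ (L2_0_iter_conv_op _ Lg))).
  by rewrite -exprM mulnC exprM ler_wpM2l// exprn_ge0// ltW.
rewrite {1}(divn_eq k n) iterD.
apply: (le_trans (iq _ _ (L2_0_iter_conv_op _ Lf))).
apply: (@le_trans _ _ ((r ^+ 2) ^+ (n * (k %/ n)) * sqnorm mX f)).
  by apply: ler_wpM2l; [rewrite exprn_ge0 ?(ltW r2)|exact: contr].
rewrite mulrC -mulrA mulrCA ler_wpM2l ?sqnorm_ge0//.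
rewrite [in X in _ <= _ * X](divn_eq k n) exprD [(_ %/ _ * _)%N]mulnC.
rewrite mulrCA ler_peMr ?exprn_ge0 ?(ltW r2)//.
apply: (@le_trans _ _ (b ^+ (k %% n) * (r ^+ 2) ^+ (k %% n))).
  rewrite -exprMn exprn_ege1// mulrDl mul1r mulVf ?gt_eqF//.
  by rewrite lerDr ltW.
rewrite ler_wpM2r ?exprn_ge0 ?(ltW r2)//.
by apply: ler_weXn2l => //; rewrite ltnW// ltn_pmod.
Qed.

Lemma ae_conv_orbit_rate f r : L2 mX f -> rho < r ->
  \forall x \ae mX, exists2 K, 0 <= K & forall n,
    `| fine (\int[conv_orbit act mu n x]_y (f y)%:E)%E
       - fine (\int[mX]_y (f y)%:E)%E | <= K * r ^+ n.
Proof.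
move=> Lf rr; have rho0 := conv_op_spectral_radius_ge0.
(* The operator bound is taken at [r'], leaving room for the loss from [r'] to [r] in
   [ae_geometric_bound]. *)
pose r' := (rho + r) / 2.
have rr' : rho < r' by rewrite /r'; lra.
have r'r : r' < r by rewrite /r'; lra.
have r'0 := le_lt_trans rho0 rr'; have r0 := lt_trans r'0 r'r.
have [C C0 hC] := sqnorm_iter_conv_op rr'.
set c := fine (\int[mX]_y (f y)%:E)%E.
pose h x := f x - c.
have Lh : L2_0 mX h.
  split; first exact: L2B (L2_cst _ _).
  rewrite RintegralB//; [|exact: L2_integrable|exact: L2_integrable (L2_cst _ _)].
  by rewrite Rintegral_cst// [X in fine X]probability_setT /= mulr1 subrr.
have Lk k := L2_0_iter_conv_op k Lh.
have bnd : \forall x \ae mX, exists2 K, 0 <= K &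
    forall n, (iter n T h x) ^+ 2 <= K * (r ^+ 2) ^+ n.
  apply: (@ae_geometric_bound _ _ _ mX (fun n x => (iter n T h x) ^+ 2)
    (C * sqnorm mX h) (r' ^+ 2)) => [n|n x|||n].
  - by apply: measurable_funX; have [[]] := Lk n.
  - exact: sqr_ge0.
  - by rewrite mulr_ge0// sqnorm_ge0.
  - by rewrite sqr_ge0 ltr_pXn2r ?nnegrE ?ltW.
  - by rewrite sqnormE ?lee_fin; [exact: hC|have [] := Lk n].
apply: filterS3 bnd (ae_integral_conv_orbit mu mact inv Lh.1)
  (ae_integrable_conv_orbit mu mact inv (L2_integrable Lf)) => x [K K0 hK] hx fi.
exists (Num.sqrt K); first exact: sqrtr_ge0.
move=> n.
have -> : fine (\int[conv_orbit act mu n x]_y (f y)%:E)%E - c = iter n T h x.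
  have := hx n; have := fi n; have [P ->] := conv_orbit_probability mu mact n x => Pf e.
  have : (\int[P]_y h y = \int[P]_y f y - c)%R.
    rewrite RintegralB//; last exact: (L2_integrable (L2_cst P c)).
    by rewrite Rintegral_cst// [X in _ * fine X]probability_setT /= mulr1.
  by rewrite /Rintegral e /= => ->.
rewrite -(@ler_pXn2r _ 2) ?nnegrE ?mulr_ge0 ?sqrtr_ge0 ?exprn_ge0 ?(ltW r0)//.
by rewrite real_normK ?num_real// exprMn sqr_sqrtr// -exprM mulnC exprM.
Qed.

Lemma ae_conv_orbit_limn_esup f : L2 mX f -> rho < 1 ->
  \forall x \ae mX, (limn_esup (fun n : nat =>
    ((`| fine (\int[conv_orbit act mu n x]_y (f y)%:E)%E
         - fine (\int[mX]_y (f y)%:E)%E |) `^ (n%:R^-1))%:E)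
    <= (Num.sqrt rho)%:E)%E.
Proof.
move=> Lf rho1; have rho0 := conv_op_spectral_radius_ge0.
(* Countably many rates decreasing to [rho] keep the exceptional set null. *)
have k0 k : rho < rho + k.+1%:R^-1 by rewrite ltrDl invr_gt0.
apply: filterS (ae_foralln (fun k => ae_conv_orbit_rate Lf (k0 k))) => x hx.
(* The argument yields the bound [rho], which is at most its square root because [rho < 1]. *)
apply: (@le_trans _ _ rho%:E); last first.
  rewrite lee_fin -{1}(sqr_sqrtr rho0) expr2 ler_piMr ?sqrtr_ge0//.
  by rewrite -sqrtr1 ler_wsqrtr// ltW.
apply/lee_addgt0Pr => e e0.
have [k ke] : exists k : nat, k.+1%:R^-1 < e.
  exists (Num.bound e^-1); rewrite invf_plt ?posrE//.
  apply: (@lt_trans _ _ (Num.bound e^-1)%:R); last by rewrite ltr_nat.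
  by apply: archi_boundP; rewrite invr_ge0 ltW.
have [K K0 hK] := hx k.
rewrite -EFinD; apply: (@limn_esup_root_le _ _ K (rho + k.+1%:R^-1)) => //.
by rewrite ltrD2l ke andbT addr_ge0.
Qed.

End convolution_rate.

(** * Weak convergence *)

Section countable_base.
Context (R : realType) (X : topologicalType).

(** The filter of finite lists ordered by inclusion; fed to the near-covering form of compactness,
    it produces finite subcovers. *)
Definition superseqs (T : eqType) : set_system (seq T) :=
  [set A : set (seq T) | exists s0 : seq T, forall s : seq T, {subset s0 <= s} -> A s].

Lemma superseqs_filter (T : eqType) : Filter (@superseqs T).
Proof.
split=> [|A B [s hs] [t ht]|A B AB [s hs]].
- by exists [::].
- exists (s ++ t) => u stu; split; [apply: hs|apply: ht] => x xs; apply: stu;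
    by rewrite mem_cat xs ?orbT.
- by exists s => u /hs /AB.
Qed.

Lemma compact_finite_cover (T : eqType) (K : set X) (Q : T -> X -> Prop) :
  compact K -> (forall x, K x -> exists t, nbhs x (Q t)) ->
  exists s : seq T, forall x, K x -> exists2 t, t \in s & Q t x.
Proof.
move=> /compact_near_coveringP cK hQ.
have [|s0 hs] := cK _ (@superseqs T) (fun s x => exists2 t, t \in s & Q t x) (superseqs_filter T).
  move=> x Kx; have [t ht] := hQ x Kx.
  exists (Q t, [set s : seq T | t \in s]).
    by split => //; exists [:: t] => s; apply; rewrite mem_head.
  by move=> [y s] /= [Qy ts]; exists t.
by exists s0 => x; apply: hs.
Qed.

Definition countable_base (W : nat -> set X) : Prop :=
  (forall i, open (W i)) /\
  (forall (A : set X) x, open A -> A x -> exists2 i, W i x & W i `<=` A).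

(** Each compact piece is covered by finitely many balls of radius [1/(k+1)]; all these balls
    together form the base. *)
Lemma sigma_compact_metrizable_countable_base :
  sigma_compact X -> metrizable R X -> exists W, countable_base W.
Proof.
move=> [K [cK KT]] [dist [d0 dC dT openP]].
pose b c (k : nat) : set X := [set y | dist c y < k.+1%:R^-1].
have dxx x : dist x x = 0 by exact/d0.
have bo c k : open (b c k).
  apply/openP => x cx; exists (k.+1%:R^-1 - dist c x); first by rewrite subr_gt0.
  by move=> y xy; apply: (le_lt_trans (dT c x y)); rewrite -ltrBrDl; exact: xy.
have bc c k : b c k c by rewrite /b /= dxx invr_gt0.
have cover (nk : nat * nat) : exists s : seq X, forall x, K nk.1 x ->
    exists2 c, c \in s & b c nk.2 x.
  apply: (compact_finite_cover (cK nk.1)) => x _.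
  by exists x; apply: open_nbhs_nbhs; split.
have [S hS] := choice cover.
(* The index codes [(n, k, j)]: the [j]-th ball of the cover of [K n] at scale [k]. Other indices
   give the empty set. *)
pose W (i : nat) : set X := if unpickle i is Some (n, k, j) then
  if drop j (S (n, k)) is c :: _ then b c k else set0 else set0.
exists W; split=> [i|A x oA Ax].
  rewrite /W; case: unpickle => [[[n k] j]|]; last exact: open0.
  by case: drop => [|c s]; [exact: open0|exact: bo].
have [e e0 eA] := (openP A).1 oA x Ax.
have [n _ Kn] : (\bigcup_n K n) x by rewrite KT.
have [k ke] : exists k : nat, k.+1%:R^-1 < e / 2.
  exists (Num.bound (e / 2)^-1); rewrite invf_plt ?posrE ?divr_gt0//.
  apply: (@lt_trans _ _ (Num.bound (e / 2)^-1)%:R); last by rewrite ltr_nat.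
  by apply: archi_boundP; rewrite invr_ge0 divr_ge0// ltW.
have [c cS cx] := hS (n, k) x Kn.
have We : W (pickle (n, k, index c (S (n, k)))) = b c k.
  by rewrite /W pickleK (drop_nth c) ?index_mem// nth_index.
exists (pickle (n, k, index c (S (n, k)))); rewrite We//.
move=> y cy; apply: eA => /=; apply: (le_lt_trans (dT x c y)).
rewrite dC (splitr e); apply: ltrD; first exact: lt_trans cx ke.
exact: lt_trans cy ke.
Qed.

End countable_base.

Lemma bounded_integrable (R : realType) (d : measure_display) (X : measurableType d)
    (Q : probability X R) (C : R) (g : X -> R) : measurable_fun setT g ->
  (forall y, `|g y| <= C) -> Q.-integrable setT (EFin \o g).
Proof.
move=> mg gC; apply: (@le_integrable _ _ _ _ _ measurableT _ (EFin \o fun=> C)).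
- exact/measurable_EFinP.
- by move=> y _; rewrite /= lee_fin; exact: le_trans (gC y) (ler_norm _).
- exact: (L2_integrable (L2_cst Q C)).
Qed.

(** * From convergence on a countable family of sets to weak* convergence *)

Section weak_convergence.
Context (R : realType) (d : measure_display) (X : topMeasType d).
Hypothesis bX : borel_space X.
Variable W : nat -> set X.
Hypothesis Wb : countable_base W.

Lemma open_measurable_borel (A : set X) : open A -> measurable A.
Proof. by move=> oA; rewrite bX; exact: sub_sigma_algebra. Qed.

Lemma continuous_measurable_borel (f : X -> R) : continuous f -> measurable_fun setT f.
Proof.
move=> cf; apply: (measurability (@RGenOInfty.G R)); first exact: RGenOInfty.measurableE.
move=> _ [_ [x ->] <-]; rewrite setTI; apply: open_measurable_borel.
by apply: open_comp => //; move=> y _; exact: cf.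
Qed.

Definition base_union (s : seq nat) : set X := [set x | exists2 i, i \in s & W i x].

Lemma base_union_cons i s : base_union (i :: s) = W i `|` base_union s.
Proof.
apply/seteqP; split=> x /=.
  by move=> [j]; rewrite inE => /predU1P[->|js] Wj; [left|right; exists j].
move=> [Wi|[j js Wj]]; first by exists i => //; rewrite mem_head.
by exists j => //; rewrite inE js orbT.
Qed.

Lemma measurable_base_union s : measurable (base_union s).
Proof.
elim: s => [|i s IH]; last first.
  rewrite base_union_cons; apply: measurableU => //.
  by apply: open_measurable_borel; case: Wb.
by rewrite (_ : base_union [::] = set0)//; apply/seteqP; split => x // [].
Qed.

(** These sets form a countable family, and cut any finite union of base sets into disjoint
    pieces. *)
Definition base_diff (p : nat * seq nat) : set X := W p.1 `\` base_union p.2.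

Lemma measurable_base_diff p : measurable (base_diff p).
Proof.
apply: measurableD; last exact: measurable_base_union.
by apply: open_measurable_borel; case: Wb.
Qed.

Variables (P : nat -> probability X R) (m : probability X R).
Hypothesis PD : forall p, fine (P n (base_diff p)) @[n --> \oo] --> fine (m (base_diff p)).

(** Each new base set adds a constant on the part of it not yet covered, which is a set of the
    family where convergence is assumed. *)
Lemma step_approximation (f : X -> R) (e : R) (s : seq nat) : 0 <= e ->
  (forall i, i \in s -> forall y z, W i y -> W i z -> `|f y - f z| <= e) ->
  exists phi : X -> R, [/\ forall y, base_union s y -> `|f y - phi y| <= e,
    forall y, ~ base_union s y -> phi y = 0,
    measurable_fun setT phi, exists B, forall y, `|phi y| <= B &
    (\int[P n]_y phi y)%R @[n --> \oo] --> (\int[m]_y phi y)%R].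
Proof.
move=> e0; elim: s => [|i s IH] hs.
  exists (fun=> 0); split => //; first by move=> y [].
  - by exists 0 => y; rewrite normr0.
  - under eq_fun do rewrite Rintegral_cst// mul0r.
    by rewrite Rintegral_cst// mul0r; exact: cvg_cst.
have [|phi [h1 h2 mphi [B hB] cphi]] := IH.
  by move=> j js; apply: hs; rewrite inE js orbT.
pose D := base_diff (i, s).
have mD : measurable D by exact: measurable_base_diff.
have [c hc] : exists c, forall y, W i y -> `|f y - c| <= e.
  have [[z Wz]|nW] := pselect (W i !=set0).
    by exists (f z) => y Wy; apply: (hs i) => //; exact: mem_head.
  by exists 0 => y Wy; exfalso; apply: nW; exists y.
have iD (Q : probability X R) : Q.-integrable setT (EFin \o \1_D).
  apply: (@bounded_integrable _ _ _ Q 1) => [|y]; first exact: (measurable_indic mD).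
  by rewrite indicE normr_nat lern1 leq_b1.
have RD (Q : probability X R) :
    (\int[Q]_y (phi y + c * \1_D y))%R = (\int[Q]_y phi y)%R + c * fine (Q D).
  rewrite RintegralD//; [|exact: (@bounded_integrable _ _ _ Q B)|exact: (integrable_mulr c (iD Q))].
  rewrite (RintegralZl c measurableT (iD Q)); congr (_ + c * fine _).
  by rewrite integral_indic// setIT.
exists (fun y => phi y + c * \1_D y); split.
- move=> y; rewrite base_union_cons => Uy; rewrite indicE.
  have [sy|nsy] := pselect (base_union s y).
    rewrite memNset ?mulr0 ?addr0; first exact: h1.
    by move=> [_]; apply.
  case: Uy => // Wy; rewrite mem_set; last by split.
  by rewrite h2// add0r mulr1; exact: hc.
- move=> y; rewrite base_union_cons => nU; rewrite indicE memNset.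
    by rewrite mulr0 addr0; apply: h2 => sy; apply: nU; right.
  by move=> [Wy _]; apply: nU; left.
- by apply: measurable_funD => //; apply: measurable_funM => //; exact: (measurable_indic mD).
- exists (B + `|c|) => y; apply: (le_trans (ler_normD _ _)); apply: lerD => //.
  by rewrite normrM ler_piMr// indicE normr_nat lern1 leq_b1.
- rewrite RD; under eq_fun do rewrite RD.
  by apply: cvgD => //; apply: cvgMr; exact: PD.
Qed.

(** The support is covered by finitely many base sets of small oscillation; the resulting step
    function is uniformly close to [f], and the claim follows with three terms [e / 3]. *)
Lemma weak_convergence (f : X -> R) : continuous f ->
  compact (closure [set y | f y != 0]) ->
  (\int[P n]_y (f y)%:E)%E @[n --> \oo] --> (\int[m]_y (f y)%:E)%E.
Proof.
move=> cf cS; have mf := continuous_measurable_borel cf.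
have approx e : 0 < e -> exists phi : X -> R, [/\ forall y, `|f y - phi y| <= e,
    measurable_fun setT phi, exists B, forall y, `|phi y| <= B &
    (\int[P n]_y phi y)%R @[n --> \oo] --> (\int[m]_y phi y)%R].
  move=> e0.
  pose Q i x := W i x /\ forall y z, W i y -> W i z -> `|f y - f z| <= e.
  have [x _|s hs] := @compact_finite_cover _ _ _ Q cS.
    have [Wo Wx] := Wb.
    have [||i Wi Wsub] := Wx (f @^-1` ball (f x) (e / 2)) x.
    - by apply: open_comp => [y _|]; [exact: cf|apply: ball_open; rewrite divr_gt0].
    - by apply: ballxx; rewrite divr_gt0.
    exists i; apply: filterS (open_nbhs_nbhs (conj (Wo i) Wi)) => y Wy; split => //.
    move=> u v /Wsub Wu /Wsub Wv.
    have xu : `|f x - f u| < e / 2 by exact: Wu.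
    have xv : `|f x - f v| < e / 2 by exact: Wv.
    apply: (le_trans (ler_distD (f x) _ _)); rewrite (splitr e); apply: lerD.
      by rewrite distrC ltW.
    exact: ltW.
  (* The list may contain sets of large oscillation. Dropping them leaves the support covered, since
     [Q] includes the oscillation bound; off the cover both [f] and the step function vanish. *)
  pose s' := [seq i <- s | `[< forall y z, W i y -> W i z -> `|f y - f z| <= e >]].
  have [|i|phi [h1 h2 mphi Bphi cphi]] := @step_approximation f e s'.
  - exact: ltW.
  - by rewrite mem_filter => /andP[/asboolP].
  exists phi; split => // y.
  have [sy|nsy] := pselect (base_union s' y); first exact: h1.
  rewrite (h2 _ nsy) subr0; have [->|fy] := eqVneq (f y) 0; first by rewrite normr0 ltW.
  exfalso; apply: nsy; have [|i si [Wi hi]] := hs y; first exact: subset_closure.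
  by exists i => //; rewrite mem_filter si andbT; apply/asboolP.
(* Boundedness of [f] is read off from one bounded step approximation. *)
have [Bf hBf] : exists B, forall y, `|f y| <= B.
  have [phi [h _ [B hB] _]] := approx 1 ltr01.
  exists (1 + B) => y; have := ler_normD (f y - phi y) (phi y); rewrite subrK.
  by have := h y; have := hB y; lra.
have fi (Q : probability X R) : Q.-integrable setT (EFin \o f).
  exact: (@bounded_integrable _ _ _ Q Bf).
have finf (Q : probability X R) : (\int[Q]_y (f y)%:E)%E \is a fin_num.
  exact: (integrable_fin_num measurableT (fi Q)).
rewrite -(fineK (finf m)); apply: cvg_EFin; first exact: nearW.
apply/cvgrPdist_lt => e e0.
have e3 : 0 < e / 3 by rewrite divr_gt0.
have [phi [h mphi [B hB] /cvgrPdist_lt /(_ _ e3) [n0 _ hn0]]] := approx _ e3.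
exists n0 => // n /hn0 /= hn.
have close (Q : probability X R) :
    `|(\int[Q]_y f y)%R - (\int[Q]_y phi y)%R| <= e / 3.
  have phii : Q.-integrable setT (EFin \o phi) by exact: (@bounded_integrable _ _ _ Q B).
  have di : Q.-integrable setT (EFin \o (fun y => f y - phi y)).
    by apply: (@bounded_integrable _ _ _ Q (e / 3)) => //; exact: measurable_funB.
  rewrite -(RintegralB measurableT (fi Q) phii).
  apply: (le_trans (le_normr_Rintegral measurableT di)).
  apply: (@le_trans _ _ (\int[Q]_y (e / 3))%R).
    apply: le_Rintegral => //.
    - apply: (@bounded_integrable _ _ _ Q (e / 3)) => [|y]; last by rewrite normr_id.
      by apply: measurableT_comp => //; exact: measurable_funB.
    - exact: (L2_integrable (L2_cst Q (e / 3))).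
  by rewrite Rintegral_cst// [X in _ * fine X]probability_setT mulr1.
have := close m; have := close (P n); rewrite -/(Rintegral m setT f) -/(Rintegral (P n) setT f).
set a := Rintegral m setT f; set b := Rintegral (P n) setT f => hb ha.
have -> : a - b = (a - Rintegral m setT phi) +
  (Rintegral m setT phi - Rintegral (P n) setT phi) - (b - Rintegral (P n) setT phi) by ring.
apply: (le_lt_trans (ler_normB _ _)).
have := ler_normD (a - Rintegral m setT phi) (Rintegral m setT phi - Rintegral (P n) setT phi).
move: ha hb hn; lra.
Qed.

End weak_convergence.

(** The rate is applied to the indicators of the countable family, with one common null set; away
    from it all test functions are treated at once. *)
Lemma ae_weak_convergence (R : realType) (dG dX : measure_display)
    (G : measurableType dG) (X : topMeasType dX) (act : G -> X -> X)
    (mX : probability X R) (mu : probability G R) (W : nat -> set X) :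
  borel_space X -> countable_base W ->
  measurable_fun setT (fun p : G * X => act p.1 p.2) -> invariant_measure act mX ->
  spectral_radius mX (conv_op act mu) < 1 ->
  \forall x \ae mX, forall f : X -> R,
    continuous f -> compact (closure [set y | f y != 0]) ->
    (\int[conv_orbit act mu n x]_y (f y)%:E)%E @[n --> \oo] -->
      (\int[mX]_y (f y)%:E)%E.
Proof.
move=> bX Wb mact inv gap.
have rho0 := @conv_op_spectral_radius_ge0 _ _ _ _ _ _ mX mu mact inv.
pose r := (spectral_radius mX (conv_op act mu) + 1) / 2.
have rr : spectral_radius mX (conv_op act mu) < r by rewrite /r; lra.
have r1 : `|r| < 1 by rewrite ger0_norm /r; lra.
(* The family is enumerated by decoding [i]; codes of nothing give the zero function. *)
pose ind i : X -> R := if unpickle i is Some p then \1_(base_diff W p) else cst 0.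
have Lind i : L2 mX (ind i).
  rewrite /ind; case: unpickle => [p|]; last exact: L2_cst.
  apply: L2_le (L2_cst mX 1) _ => [|x].
    exact/measurable_indic/measurable_base_diff.
  by rewrite indicE expr1n; case: (_ \in _); rewrite ?expr1n ?expr0n.
apply: filterS (ae_foralln (fun i => ae_conv_orbit_rate mact inv (Lind i) rr)) => x hx f cf cS.
have [P hP] := choice (fun n => conv_orbit_probability mu mact n x).
under eq_fun do rewrite hP.
apply: (weak_convergence bX Wb _ cf cS) => p.
have [K K0 hK] := hx (pickle p).
have e (Q : probability X R) :
    fine (\int[Q]_y (ind (pickle p) y)%:E)%E = fine (Q (base_diff W p)).
  rewrite /ind pickleK integral_indic ?setIT//.
  exact: measurable_base_diff.
apply/cvgrPdist_lt => eps eps0.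
have /cvgrPdist_lt /(_ eps eps0) [n0 _ hn0] := @cvg_geometric R K _ r1.
exists n0 => // n /hn0 /=; rewrite sub0r normrN => h.
rewrite distrC; have := hK n; rewrite hP !e => /le_lt_trans; apply.
exact: le_lt_trans (ler_norm _) h.
Qed.

Theorem theorem3p2 (R : realType) (dG dX : measure_display)
  (G : topMeasType dG) (X : topMeasType dX)
  (mul : G -> G -> G) (inv : G -> G) (one : G) (act : G -> X -> X)
  (mX : probability X R) (mu : probability G R) :
  borel_space G -> borel_space X ->
  lcsc_metrizable R G -> lcsc_metrizable R X ->
  topological_group mul inv one ->
  is_action mul one act ->
  measurable_fun setT (fun p : G * X => act p.1 p.2) ->
  invariant_measure act mX -> ergodic_measure act mX ->
  spectral_gap mX (conv_op act mu) ->
  (\forall x \ae mX, forall f : X -> R,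
      continuous f -> compact (closure [set y | f y != 0]) ->
      (\int[conv_orbit act mu n x]_y (f y)%:E)%E @[n --> \oo] -->
        (\int[mX]_y (f y)%:E)%E) /\
  (forall f : X -> R, L2 mX f ->
    \forall x \ae mX,
      (forall n, (conv_orbit act mu n x).-integrable setT (EFin \o f)) /\
      (limn_esup (fun n : nat =>
         ((`| fine (\int[conv_orbit act mu n x]_y (f y)%:E)%E
              - fine (\int[mX]_y (f y)%:E)%E |) `^ (n%:R^-1))%:E)
        <= (Num.sqrt (spectral_radius mX (conv_op act mu)))%:E)%E).
Proof.
move=> _ bX _ [_ sX metX] _ _ mact invm _ gap; split=> [|f Lf].
  have [W Wb] := sigma_compact_metrizable_countable_base sX metX.
  exact: ae_weak_convergence Wb mact invm gap.
(* Integrability at every [n] ensures that the [fine] integrals in the rate are actual integrals and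
   not default values. *)
apply: filterS2 (ae_integrable_conv_orbit mu mact invm (L2_integrable Lf))
  (ae_conv_orbit_limn_esup mact invm Lf gap) => x ix lx.
by split.
Qed.
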